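(* Let $f:\mathbb{T}^2\to\mathbb{T}^2$ be an area preserving toral endomorphism of degree at least two. If $f$ is not transitive, then $f$ is homotopic to a linear map (induced by a non-singular $2\times 2$ integer matrix) which has a real eigenvalue of modulus one.
   Context: $\mathbb{T}^2=\mathbb{R}^2/\mathbb{Z}^2$ with Haar (Lebesgue) measure $\lambda$. A toral endomorphism is a local homeomorphism $f:\mathbb{T}^2\to\mathbb{T}^2$ (equivalently a covering map of the torus to itself). It is area preserving if $\lambda(f^{-1}(B))=\lambda(B)$ for every Borel set $B\subset\mathbb{T}^2$. Every endomorphism is homotopic to exactly one map induced by a non-singular integer $2\times2$ matrix $A$ (its action on $\pi_1(\mathbb{T}^2)\cong\mathbb{Z}^2$); the degree of $f$ (number of sheets) is $|\det A|$, the cardinality of every preimage $f^{-1}(x)$. $f$ is transitive if there is $x\in\mathbb{T}^2$ whose forward orbit $\{f^n(x):n\ge 0\}$ is dense in $\mathbb{T}^2$. *)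

(* Defs.v *)
From HB Require Import structures.
From mathcomp Require Import all_boot all_order all_algebra.
From mathcomp Require Import generic_quotient.
From mathcomp Require Import all_classical all_reals all_analysis.
Set Implicit Arguments. Unset Strict Implicit. Unset Printing Implicit Defensive.
Import Order.TTheory GRing.Theory Num.Theory.
Import numFieldNormedType.Exports.
Local Open Scope classical_set_scope.
Local Open Scope ring_scope.

Section Torus.
Variable R : realType.

Definition zeq (x y : R * R) : bool :=
  (x.1 - y.1 \is a Num.int) && (x.2 - y.2 \is a Num.int).

Lemma zeq_refl : reflexive zeq.
Proof. by move=> x; rewrite /zeq !subrr rpred0. Qed.

Lemma zeq_sym : symmetric zeq.
Proof.
by move=> x y; rewrite /zeq -(rpredN _ (x.1 - y.1)) -(rpredN _ (x.2 - y.2)) !opprB.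
Qed.

Lemma zeq_trans : transitive zeq.
Proof.
move=> y x z /andP[h1 h2] /andP[h3 h4]; apply/andP; split.
- by rewrite -(subrKA y.1); apply: rpredD.
- by rewrite -(subrKA y.2); apply: rpredD.
Qed.

Canonical zeq_equiv := EquivRel zeq zeq_refl zeq_sym zeq_trans.

Definition torus_quot := {eq_quot zeq}%qT.
Definition torus := @quotient_topology (R * R)%type torus_quot.


Definition tpi (x : R * R) : torus := (\pi_torus_quot x)%qT.
Definition trepr (p : torus) : R * R := repr (p : torus_quot).

Definition torus_borel (B : set torus) : Prop := <<s open >> B.

(* Haar (Lebesgue) measure of the torus: Lebesgue measure on R^2 of the
   part of the lift of B lying in the fundamental domain [0,1)^2. *)
Definition torus_lambda (B : set torus) : \bar R :=
  ((@lebesgue_measure R) \x (@lebesgue_measure R))%E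
    [set x : measurableTypeR R * measurableTypeR R |
       (0 <= x.1 < 1) /\ (0 <= x.2 < 1) /\ B (tpi (x.1, x.2))].

Definition torus_lin (A : 'M[int]_2) (p : torus) : torus :=
  let x := trepr p in
  tpi ((A 0 0)%:~R * x.1 + (A 0 1)%:~R * x.2,
       (A 1 0)%:~R * x.1 + (A 1 1)%:~R * x.2).

End Torus.

(* local homeomorphism: continuous, and every point has an open
   neighbourhood U on which f is injective and open, i.e. f|_U is a
   homeomorphism onto the open set f(U) *)
Definition local_homeo (T : topologicalType) (f : T -> T) : Prop :=
  continuous f /\
  forall x, exists U : set T, [/\ open U, U x, {in U &, injective f} &
     forall V : set T, open V -> V `<=` U -> open (f @` V)].

Definition homotopic (R : realType) (T : topologicalType) (f g : T -> T) : Prop :=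
  exists H : T * R -> T,
    [/\ {within [set p : T * R | 0 <= p.2 <= 1], continuous H},
        forall x, H (x, 0) = f x & forall x, H (x, 1) = g x].

Definition transitive_map (T : topologicalType) (f : T -> T) : Prop :=
  exists x : T, dense (range (fun n : nat => iter n f x)).

(* Main.v *)
Require Import Defs.
From HB Require Import structures.
From mathcomp Require Import all_boot all_order all_algebra.
From mathcomp Require Import generic_quotient.
From mathcomp Require Import all_classical all_reals all_analysis.
From mathcomp Require Import zify ring lra.
Import Order.TTheory GRing.Theory Num.Theory.
Import numFieldNormedType.Exports.
Local Open Scope classical_set_scope.
Local Open Scope ring_scope.
Set Implicit Arguments.
Unset Strict Implicit.
Unset Printing Implicit Defensive.

(* Lift f to F : R^2 -> R^2 with F (x + k) = F x + A k. Then f is homotopic to A,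
   F is a homeomorphism, and so |det A| >= 2. If f is not transitive, area
   preservation yields disjoint open periodic sets U', V' that are fully invariant
   under F. The components of such a set, taken modulo Z^2, have areas that do not
   decrease along orbits, so some component O is periodic: G = F^n maps O into a
   translate of O, and the preimage under G of the union of the translates of O is
   that union. Hence the stabilizer H of O in Z^2 satisfies A^n H <= H and
   H + A^n Z^2 = Z^2. As |det A| >= 2, H is not trivial. If H has rank one, A^n
   acts on Z^2 / H as a sign up to torsion, and A has a real eigenvalue of modulus
   one. Otherwise both U' and V' have a component that is invariant under a
   sublattice of rank two; a horizontally periodic chain in the one and a
   vertically periodic chain in the other must cross, by a discrete winding number
   argument, contradicting that U' and V' are disjoint. *)

(** * Topology of the plane *)

(** Area preservation acts three times, each time because a nonempty open periodic set has positive
    area: it makes the preimage of a backward invariant open set dense in that set, so that the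
    closure is fully invariant; it forces components along an orbit to meet again modulo [Z^2]; and
    it shows that no component other than the translates of O is sent into them. The bound on the
    determinant acts twice. If H were trivial, A^n would be onto [Z^2] and have determinant of
    modulus one. And the eigenvector of A^n passes to A only thanks to it: a rotation A of order
    four has A^4 = 1 but no real eigenvalue. The planar obstacle is the crossing of two periodic
    connected open sets. It is reduced to finite chains, whose mesh is chosen after the margin that
    one chain keeps inside its open set; then only signs have to be counted. *)

Section PlaneTopology.
Variable R : realType.
Implicit Types (x y : R * R) (S : set (R * R)) (r : R).

Lemma plane_nbhsP x S :
  nbhs x S <-> exists2 r : R, 0 < r & forall y, `|y - x| < r -> S y.
Proof.
rewrite (@nbhs_ballP R (R * R)%type x S); split=> [] [r /= r0 rS]; exists r => // y.
- by move=> yx; apply: rS; rewrite -ball_normE /ball_/= distrC.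
- by rewrite -ball_normE /ball_/= distrC => /rS.
Qed.

Lemma plane_openP S :
  open S <-> forall x, S x -> exists2 r : R, 0 < r & forall y, `|y - x| < r -> S y.
Proof.
rewrite openE; split=> So x Sx.
- exact/plane_nbhsP/So.
- exact/plane_nbhsP/So.
Qed.

Lemma disk_open x (r : R) : open [set y | `|y - x| < r].
Proof.
apply/plane_openP => y /= yx; exists (r - `|y - x|); first by rewrite subr_gt0.
by move=> z zy /=; apply: le_lt_trans (ler_distD y _ _) _; rewrite -ltrBrDr.
Qed.

Lemma plane_continuousP (f : R * R -> R * R) :
  continuous f <-> forall x (eps : R), 0 < eps ->
    exists2 r : R, 0 < r & forall y, `|y - x| < r -> `|f y - f x| < eps.
Proof.
split=> fc x.
- move=> eps eps0.
  have : nbhs (f x) [set z | `|z - f x| < eps] by apply/plane_nbhsP; exists eps.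
  by move/(fc x)/plane_nbhsP.
- move=> A /plane_nbhsP[eps eps0 epsA]; have [r r0 rf] := fc x eps eps0.
  by apply/plane_nbhsP; exists r => // y /rf/epsA.
Qed.

Lemma norm_pair x : `|x| = Num.max `|x.1| `|x.2|.
Proof. by rewrite prod_normE. Qed.

Lemma norm_pair_lt x r : (`|x| < r) = (`|x.1| < r) && (`|x.2| < r).
Proof. by rewrite norm_pair gt_max. Qed.

(** Countable base of the plane: the disk of radius [n.+1%:R^-1] about the rational point contains
    [x], and the second inequality puts it inside the disk of radius [r] about [x]. *)
Lemma rational_disk x (r : R) : 0 < r -> exists (p q : rat) (n : nat),
  `|(ratr p, ratr q) - x| < n.+1%:R^-1 /\ n.+1%:R^-1 + n.+1%:R^-1 < r.
Proof.
move=> r0.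
have near_rat (c d : R) : 0 < d -> exists q : rat, `|ratr q - c| < d.
  move=> d0; have /rat_in_itvoo[q] : c - d < c + d by rewrite ltrD2l gtrN.
  rewrite in_itv/= => /andP[q1 q2]; exists q.
  by rewrite ltr_norml; apply/andP; split; lra.
pose n := Num.truncn (2 / r).
have n0 : 0 < n.+1%:R^-1 :> R by rewrite invr_gt0 ltr0n.
have [p px] := near_rat x.1 _ n0; have [q qx] := near_rat x.2 _ n0.
exists p, q, n; split; first by rewrite norm_pair_lt /= px qx.
rewrite -mulr2n -(mulr_natl _ 2) ltr_pdivrMr ?ltr0n// mulrC -ltr_pdivrMr//.
exact: truncnS_gt.
Qed.

End PlaneTopology.

(** * Crossing of periodic connected sets *)

Section DiscreteWinding.

(* The signs (a > 0, b > 0) of a nonzero vector (a, b) encode its quadrant;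
   [turn p q] is the signed number of quarter turns from [p] to [q]. *)
Definition turn (p q : bool * bool) : int :=
  match p, q with
  | (true, true), (false, true) | (false, true), (false, false)
  | (false, false), (true, false) | (true, false), (true, true) => 1
  | (false, true), (true, true) | (false, false), (false, true)
  | (true, false), (false, false) | (true, true), (true, false) => -1
  | _, _ => 0
  end.

(** Between opposite quadrants the direction of rotation is ambiguous and the value 0 of [turn] is a
    mere default; this predicate excludes that case. *)
Definition not_opposite (p q : bool * bool) := (p.1 == q.1) || (p.2 == q.2).

(** Pairwise non-opposite quadrants occupy at most two adjacent ones, on which [turn] is the
    difference of a potential. *)
Lemma turn_square (a b c d : bool * bool) :
  not_opposite a b -> not_opposite a c -> not_opposite a d ->
  not_opposite b c -> not_opposite b d -> not_opposite c d ->
  turn a b + turn b d = turn a c + turn c d.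
Proof. by case: a b c d => [[][]] [[][]] [[][]] [[][]]. Qed.

(** On each of the four half planes [turn] is, up to sign, the increment of one sign bit, so its sum
    along a side of the grid telescopes. *)
Lemma turn_left (b b' : bool) : turn (false, b) (false, b') = b%:Z - b'%:Z.
Proof. by case: b b' => [] []. Qed.

Lemma turn_right (b b' : bool) : turn (true, b) (true, b') = b'%:Z - b%:Z.
Proof. by case: b b' => [] []. Qed.

Lemma turn_down (a a' : bool) : turn (a, false) (a', false) = a'%:Z - a%:Z.
Proof. by case: a a' => [] []. Qed.

Lemma turn_up (a a' : bool) : turn (a, true) (a', true) = a%:Z - a'%:Z.
Proof. by case: a a' => [] []. Qed.

(* Walking around the grid the quadrant would make a full turn, although it
   makes no turn around any cell. *)
Lemma no_full_turn (m n : nat) (q : nat -> nat -> bool * bool) :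
  (forall i i' j j', (i <= i' <= i.+1)%N -> (j <= j' <= j.+1)%N ->
     not_opposite (q i j) (q i' j') /\ not_opposite (q i j') (q i' j)) ->
  (forall j, (q 0%N j).1 = false) -> (forall j, (q m j).1 = true) ->
  (forall i, (q i 0%N).2 = true) -> (forall i, (q i n).2 = false) -> False.
Proof.
move=> qN ql qr qd qu.
pose h i j := turn (q i j) (q i.+1 j); pose v i j := turn (q i j) (q i j.+1).
have cell i j : h i j + v i.+1 j = v i j + h i j.+1.
  have [n1 n2] := qN i i.+1 j j.+1 ltac:(lia) ltac:(lia).
  have [n3 _] := qN i i.+1 j j ltac:(lia) ltac:(lia).
  have [n4 _] := qN i i j j.+1 ltac:(lia) ltac:(lia).
  have [n5 _] := qN i.+1 i.+1 j j.+1 ltac:(lia) ltac:(lia).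
  have [n6 _] := qN i i.+1 j.+1 j.+1 ltac:(lia) ltac:(lia).
  apply: turn_square => //.
  by move: n2; rewrite /not_opposite !(eq_sym (_ (q i j.+1))).
(* Discrete Green formula: adding up the cells of a row, and then the rows in [grid], leaves only
   the boundary terms. *)
have row k j : \sum_(i < k) h i j + v k j = v 0%N j + \sum_(i < k) h i j.+1.
  elim: k => [|k IH]; first by rewrite !big_ord0 addr0 add0r.
  by rewrite !big_ord_recr /= -addrA cell addrA IH addrA.
have grid l : \sum_(i < m) h i 0%N + \sum_(j < l) v m j
            = \sum_(j < l) v 0%N j + \sum_(i < m) h i l.
  elim: l => [|l IH]; first by rewrite !big_ord0 addr0 add0r.
  by rewrite !big_ord_recr /= addrA IH -addrA row addrA.
have telescope (F : nat -> int) k : \sum_(i < k) (F i.+1 - F i) = F k - F 0%N.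
  by rewrite -(big_mkord xpredT (fun i => F i.+1 - F i)) telescope_sumr.
(* Of the two boundary paths from corner (0, 0) to corner (m, n), one turns by -2 quarters ([b1],
   [b3]) and the other by +2 ([b4], [b2]), while [grid] equates them. *)
have b1 : \sum_(i < m) h i 0%N = -1.
  rewrite (eq_bigr (fun i : 'I_m =>
    (- (q i.+1 0%N).1%:Z) - (- (q i 0%N).1%:Z))).
    by rewrite (telescope (fun i => - (q i 0%N).1%:Z)) ql qr.
  move=> i _; rewrite /h (surjective_pairing (q i 0%N)).
  by rewrite (surjective_pairing (q i.+1 0%N)) !qd turn_up /=; lia.
have b2 : \sum_(i < m) h i n = 1.
  rewrite (eq_bigr (fun i : 'I_m => (q i.+1 n).1%:Z - (q i n).1%:Z)).
    by rewrite (telescope (fun i => (q i n).1%:Z)) ql qr.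
  move=> i _; rewrite /h (surjective_pairing (q i n)).
  by rewrite (surjective_pairing (q i.+1 n)) !qu turn_down /=.
have b3 : \sum_(j < n) v m j = -1.
  rewrite (eq_bigr (fun j : 'I_n => (q m j.+1).2%:Z - (q m j).2%:Z)).
    by rewrite (telescope (fun j => (q m j).2%:Z)) qd qu.
  move=> j _; rewrite /v (surjective_pairing (q m j)).
  by rewrite (surjective_pairing (q m j.+1)) !qr turn_right /=.
have b4 : \sum_(j < n) v 0%N j = 1.
  rewrite (eq_bigr (fun j : 'I_n => (- (q 0%N j.+1).2%:Z) - (- (q 0%N j).2%:Z))).
    by rewrite (telescope (fun j => - (q 0%N j).2%:Z)) qd qu.
  move=> j _; rewrite /v (surjective_pairing (q 0%N j)).
  by rewrite (surjective_pairing (q 0%N j.+1)) !ql turn_left /=; lia.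
by have := grid n; rewrite b1 b2 b3 b4.
Qed.

End DiscreteWinding.

(** * Chains of small steps in open connected sets *)

Section Plane.
Variable R : realType.
Implicit Types (S O : set (R * R)) (p q x : R * R) (e r : R).

(** The conditions on [c] hold at all indices, also past [n], which keeps index bounds out of the
    arguments; a finite chain can be continued by a constant. *)
Definition chain e S p q := exists (n : nat) (c : nat -> R * R),
  [/\ c 0%N = p, c n = q, forall i, S (c i) & forall i, `|c i.+1 - c i| < e].

Lemma chain_trans e S q p x : chain e S p q -> chain e S q x -> chain e S p x.
Proof.
move=> [n [c [c0 cn cS ce]]] [m [d [d0 dm dS de]]].
exists (n + m)%N, (fun i => if (i <= n)%N then c i else d (i - n)%N).
split => //.
- case: leqP => [|_]; last by rewrite addKn.
  rewrite -{2}[n]addn0 leq_add2l leqn0 => /eqP m0.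
  by move: dm; rewrite m0 addn0 cn d0.
- by move=> i; case: ifP.
- move=> i; case: (ltngtP i n) => [lt_in|lt_ni|->].
  + by rewrite ce.
  + by rewrite subSn// ltnW.
  + by rewrite subSnn cn -d0.
Qed.

Lemma chain_sub e S S' p q : S `<=` S' -> chain e S p q -> chain e S' p q.
Proof.
move=> sub [n [c [c0 cn cS ce]]]; exists n, c; split => // i.
exact/sub/cS.
Qed.

Lemma chain_shift e S v p q : (forall x, S x -> S (x + v)) ->
  chain e S p q -> chain e S (p + v) (q + v).
Proof.
move=> Sv [n [c [c0 cn cS ce]]]; exists n, (fun i => c i + v).
split; rewrite ?c0 ?cn// => i; first exact/Sv.
by rewrite opprD addrACA subrr addr0.
Qed.

Lemma chain_segment e S p q : 0 < e ->
  (forall t, 0 <= t <= 1 -> S (p + t *: (q - p))) -> chain e S p q.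
Proof.
move=> e0 Sc.
pose n := (Num.truncn (`|q - p| / e)).+1.
have n0 : 0 < n%:R :> R by rewrite ltr0n.
have pqn : `|q - p| < e * n%:R.
  by rewrite -ltr_pdivrMl// mulrC /n truncnS_gt.
exists n, (fun i => p + ((minn i n)%:R / n%:R) *: (q - p)); split.
- by rewrite min0n mul0r scale0r addr0.
- by rewrite minnn divff ?gt_eqF// scale1r addrC subrK.
- move=> i; apply: Sc; rewrite divr_ge0//= ler_pdivrMr// mul1r ler_nat.
  exact: geq_minr.
- move=> i; rewrite opprD addrACA subrr add0r -scalerBl -mulrBl normrZ.
  rewrite normrM normfV (gtr0_norm n0) mulrAC ltr_pdivrMr//.
  apply: le_lt_trans pqn; rewrite -[leRHS]mul1r ler_wpM2r//.
  rewrite -natrB ?geq_min; last by rewrite leq_min; lia.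
  by rewrite ger0_norm// lern1; lia.
Qed.

(** The margin [r] keeps a chain away from every set disjoint from [O]; the bound [C] lets it be
    enclosed between far translates of a point of the other set. *)
Definition inner O r (C : R) : set (R * R) := [set x | ball x r `<=` O /\ `|x| <= C].

Lemma inner_sub O r r' (C C' : R) : r' <= r -> C <= C' ->
  inner O r C `<=` inner O r' C'.
Proof.
move=> rr CC x [xO xC]; split; last exact: le_trans xC CC.
exact: subset_trans (le_ball rr) xO.
Qed.

Lemma chain_inner_step O p q r e : 0 < r -> ball p (r + r) `<=` O -> ball p r q ->
  0 < e -> chain e (inner O r (`|p| + r)) p q /\ chain e (inner O r (`|p| + r)) q p.
Proof.
move=> r0 pO pq e0.
have pq' : `|q - p| < r by rewrite distrC; move: pq; rewrite -ball_normE.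
have near_p x : `|x - p| < r -> inner O r (`|p| + r) x.
  move=> xp; split.
    move=> y xy; apply: pO; apply: ball_triangle xy.
    by rewrite -ball_normE /ball_/= distrC.
  rewrite -[x](subrK p) addrC; apply: le_trans (ler_normD _ _) _.
  by rewrite lerD2l ltW.
have small t : 0 <= t <= 1 -> `|t *: (q - p)| < r.
  move=> /andP[t0 t1]; apply: le_lt_trans pq'.
  by rewrite normrZ ger0_norm// ler_piMl.
split; apply: chain_segment => // t t01; apply: near_p.
  by rewrite addrC addKr small.
have -> : q + t *: (p - q) - p = (1 - t) *: (q - p).
  by rewrite scalerBl scale1r -[p - q]opprB scalerN addrAC.
by apply: small; lra.
Qed.

(** The points reachable in this sense form a relatively clopen subset of [O]. The order of
    quantifiers matters: [r] and [C] are independent of [e], because the mesh is later taken to be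
    half the margin. *)
Lemma open_connected_chain O p q : open O -> connected O -> O p -> O q ->
  exists r C, 0 < r /\ forall e, 0 < e -> chain e (inner O r C) p q.
Proof.
move=> Oo Oc Op.
pose B := [set x | O x /\
  exists r C, 0 < r /\ forall e, 0 < e -> chain e (inner O r C) p x].
have glue x y r C r' C' : 0 < r -> 0 < r' ->
    (forall e, 0 < e -> chain e (inner O r C) p x) ->
    (forall e, 0 < e -> chain e (inner O r' C') x y) ->
  exists r C, 0 < r /\ forall e, 0 < e -> chain e (inner O r C) p y.
  move=> r0 r'0 c1 c2; exists (Num.min r r'), (Num.max C C').
  split=> [|e e0]; first by rewrite lt_min r0.
  apply: (@chain_trans _ _ x); [apply: chain_sub (c1 e e0)|apply: chain_sub (c2 e e0)];
    by apply: inner_sub; rewrite ?ge_min ?le_max lexx ?orbT.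
have half x : O x -> exists2 r, 0 < r & ball x (r + r) `<=` O.
  move=> Ox; have /nbhs_ballP[r /= r0 rO] := open_nbhs_nbhs (conj Oo Ox).
  by exists (r / 2); [rewrite divr_gt0|rewrite -splitr].
have Bo : open B.
  rewrite openE => x [Ox [r [C [r0 cx]]]]; have [s s0 sO] := half _ Ox.
  rewrite /interior -nbhs_ballE; exists s => //= y xy; split.
    by apply: sO; apply: le_ball xy; rewrite lerDl ltW.
  apply: (glue x y r C s (`|x| + s)) => // e e0.
  by have [] := chain_inner_step s0 sO xy e0.
have Co : open (O `\` B).
  rewrite openE => x [Ox nBx]; have [s s0 sO] := half _ Ox.
  rewrite /interior -nbhs_ballE; exists s => //= y xy; split.
    by apply: sO; apply: le_ball xy; rewrite lerDl ltW.
  move=> [_ [r [C [r0 cy]]]]; apply: nBx; split=> //.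
  apply: (glue y x r C s (`|x| + s)) => // e e0.
  by have [] := chain_inner_step s0 sO xy e0.
have OB : O = B.
  symmetry; apply: Oc.
  - exists p; split=> //; have [s s0 sO] := half _ Op.
    exists s, (`|p| + s); split=> // e e0.
    by have [] := chain_inner_step s0 sO (ballxx p s0) e0.
  - by exists B => //; apply/seteqP; split => [x [Ox ?]|x [Ox Bx]] //; split.
  - exists (~` (O `\` B)); first by rewrite closedC.
    apply/seteqP; split => [x Bx|x [Ox]]; first by split; [case: Bx|case].
    by move=> /not_andP[//|/contrapT].
by move=> Oq; have [] : B q by rewrite -OB.
Qed.

Lemma chain_iter e S v p (k : nat) : (forall x, S x -> S (x + v)) ->
  (forall x, S x -> S (x - v)) -> S p -> 0 < e -> chain e S p (p + v) ->
  chain e S (p - v *+ k) (p + v *+ k).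
Proof.
move=> Sv SNv Sp e0 c.
have Svk l x : S x -> S (x + v *+ l).
  by elim: l x => [|l IH] x Sx; rewrite ?mulr0n ?addr0// mulrS addrA; apply/IH/Sv.
have SNvk l x : S x -> S (x - v *+ l).
  elim: l x => [|l IH] x Sx; rewrite ?mulr0n ?subr0// mulrS opprD addrA.
  exact/IH/SNv.
have up l : chain e S p (p + v *+ l).
  elim: l => [|l IH].
    exists 0%N, (fun=> p); split => //; first by rewrite mulr0n addr0.
    by move=> _; rewrite subrr normr0.
  apply: chain_trans IH _; rewrite mulrS addrA.
  exact: chain_shift (Svk l) c.
have := chain_shift (SNvk k) (up (k + k)%N).
by rewrite mulrnDr addrA addrK.
Qed.

(* If the two chains were disjoint, the differences c i - d j would never
   vanish, and their quadrants would contradict [no_full_turn]. *)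
Lemma chains_cross S S' p q p' q' e : 0 < e ->
  chain e S p q -> chain e S' p' q' ->
  (forall x y, S x -> S' y -> e + e <= `|x - y|) ->
  (forall y, S' y -> p.1 < y.1 /\ y.1 < q.1) ->
  (forall x, S x -> p'.2 < x.2 /\ x.2 < q'.2) -> False.
Proof.
move=> e0 [m [c [c0 cm cS ce]]] [n [d [d0 dn dS de]]] far lr du.
apply: (@no_full_turn m n (fun i j => ((d j).1 < (c i).1, (d j).2 < (c i).2))).
- have stepc i i' : (i <= i' <= i.+1)%N -> `|c i' - c i| < e.
    move=> /andP[ii']; rewrite leq_eqVlt => /orP[/eqP->//|]; rewrite ltnS => i'i.
    by rewrite (_ : i' = i) ?subrr ?normr0//; apply/eqP; rewrite eqn_leq ii' i'i.
  have stepd i i' : (i <= i' <= i.+1)%N -> `|d i' - d i| < e.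
    move=> /andP[ii']; rewrite leq_eqVlt => /orP[/eqP->//|]; rewrite ltnS => i'i.
    by rewrite (_ : i' = i) ?subrr ?normr0//; apply/eqP; rewrite eqn_leq ii' i'i.
  (* A coordinate of the difference that changes sign under two moves of less than [e] is below
     [e + e] in modulus; if both did, the chains would be too close. *)
  have key x x' y y' : S x -> S' y -> `|x' - x| < e -> `|y' - y| < e ->
      not_opposite (y.1 < x.1, y.2 < x.2) (y'.1 < x'.1, y'.2 < x'.2).
    move=> Sx Sy; rewrite !norm_pair !gt_max /= => /andP[x1 x2] /andP[y1 y2].
    apply/negPn/negP; rewrite /not_opposite/= negb_or => /andP[n1 n2].
    have := far _ _ Sx Sy; rewrite norm_pair/= le_max.
    have close (a a' b b' : R) : `|a' - a| < e -> `|b' - b| < e ->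
        (b < a) != (b' < a') -> (e + e <= `|a - b|) = false.
      rewrite !ltr_norml => /andP[? ?] /andP[? ?] ab; apply/negbTE; rewrite -ltNge.
      rewrite ltr_norml; move: ab.
      by case: (ltP b a) => ?; case: (ltP b' a') => ?//= _; apply/andP; split; lra.
    by rewrite !(close _ _ _ _ _ _ n1, close _ _ _ _ _ _ n2).
  move=> i i' j j' ii jj; split; apply: key => //; try exact: stepc; try exact: stepd.
  by rewrite distrC; exact: stepd.
- by move=> j /=; rewrite c0; apply/negbTE; rewrite -leNgt ltW//; case: (lr _ (dS j)).
- by move=> j /=; rewrite cm; case: (lr _ (dS j)).
- by move=> j /=; rewrite d0; case: (du _ (cS j)).
- by move=> j /=; rewrite dn; apply/negbTE; rewrite -leNgt ltW//; case: (du _ (cS j)).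
Qed.

Lemma pair_mulrn (v : R * R) k : v *+ k = (v.1 *+ k, v.2 *+ k).
Proof.
by elim: k => [|k IH]; rewrite ?mulr0n// !mulrS IH; case: v {IH}.
Qed.

Lemma periodic_connected_meet O1 O2 (a b : R) : 0 < a -> 0 < b ->
  open O1 -> connected O1 -> O1 !=set0 -> open O2 -> connected O2 -> O2 !=set0 ->
  (forall x, O1 x -> O1 (x + (a, 0)) /\ O1 (x - (a, 0))) ->
  (forall x, O2 x -> O2 (x + (0, b)) /\ O2 (x - (0, b))) ->
  exists x, O1 x /\ O2 x.
Proof.
move=> a0 b0 o1 c1 [p Op] o2 c2 [q Oq] per1 per2.
have [r [C [r0 ch1]]] := open_connected_chain o1 c1 Op (per1 _ Op).1.
have [r' [C' [r'0 ch2]]] := open_connected_chain o2 c2 Oq (per2 _ Oq).1.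
apply: contrapT => disj.
(* With [e + e = r], a point of [O2] closer than [e + e] to a point of [S1] falls in its margin and
   hence in [O1]. *)
pose e := r / 2; have e0 : 0 < e by rewrite divr_gt0.
(* Only the coordinate that the period does not move is bounded, so that [S1] and [S2] remain
   invariant under their periods. *)
pose S1 := [set x | ball x r `<=` O1 /\ `|x.2| <= C].
pose S2 := [set x | O2 x /\ `|x.1| <= C'].
have s1 : inner O1 r C `<=` S1.
  by move=> x [? xC]; split => //; apply: le_trans xC; rewrite norm_pair le_max lexx orbT.
have s2 : inner O2 r' C' `<=` S2.
  move=> x [xO xC]; split; first by apply/xO/ballxx.
  by apply: le_trans xC; rewrite norm_pair le_max lexx.
have {}ch1 := chain_sub s1 (ch1 e e0); have {}ch2 := chain_sub s2 (ch2 e e0).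
have Sp : S1 p by move: ch1 => [n [c [<- _ + _]]].
have Sq : S2 q by move: ch2 => [n [c [<- _ + _]]].
have shift_ball x y v : ball (x + v) r y -> ball x r (y - v).
  by rewrite -!ball_normE /ball_/= opprB addrA.
have per1' x : S1 x -> S1 (x + (a, 0)).
  move=> [xO xC]; split; last by rewrite /= addr0.
  by move=> y /shift_ball /xO /per1[]; rewrite subrK.
have per1N x : S1 x -> S1 (x - (a, 0)).
  move=> [xO xC]; split; last by rewrite /= subr0.
  by move=> y /shift_ball /xO /per1[_]; rewrite opprK addrK.
have per2' x : S2 x -> S2 (x + (0, b)).
  by move=> [xO xC]; split; [case: (per2 _ xO)|rewrite /= addr0].
have per2N x : S2 x -> S2 (x - (0, b)).
  by move=> [xO xC]; split; [case: (per2 _ xO)|rewrite /= subr0].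
(* After [k] periods in either direction, the first chain ends beyond the strip that holds [S2], and
   the second beyond the strip that holds [S1]. *)
pose k := (Num.truncn ((`|p.1| + C') / a + (`|q.2| + C) / b)).+1.
have ka : `|p.1| + C' < a *+ k /\ `|q.2| + C < b *+ k.
  have C0 : 0 <= C by case: Sp => _; apply: le_trans.
  have C'0 : 0 <= C' by case: Sq => _; apply: le_trans.
  have kk := truncnS_gt ((`|p.1| + C') / a + (`|q.2| + C) / b).
  split; rewrite -mulr_natl -ltr_pdivrMr//; apply: le_lt_trans kk.
    by rewrite lerDl divr_ge0 ?addr_ge0// ltW.
  by rewrite lerDr divr_ge0 ?addr_ge0// ltW.
apply: (chains_cross e0 (chain_iter k per1' per1N Sp e0 ch1)
  (chain_iter k per2' per2N Sq e0 ch2)).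
- move=> x y [xO _] [yO _]; rewrite -splitr leNgt; apply/negP => xy.
  by apply: disj; exists y; split => //; apply: xO; rewrite -ball_normE.
- move=> y [_]; rewrite ler_norml !pair_mulrn/= => /andP[? ?]; case: ka => ka _.
  have := ler_norm p.1; have := ler_norm (- p.1); rewrite normrN => ? ?.
  by split; lra.
- move=> y [_]; rewrite ler_norml !pair_mulrn/= => /andP[? ?]; case: ka => _ ka.
  have := ler_norm q.2; have := ler_norm (- q.2); rewrite normrN => ? ?.
  by split; lra.
Qed.

End Plane.

(** * Lifting along rays *)

Lemma plane_dist4 (R : realType) (y z w x v : R * R) (d : R) : `|x - y| < d ->
  `|z - y| < d -> `|w - z| < d -> `|w - v| < d -> `|x - v| < 4 * d.
Proof.
rewrite (distrC z) (distrC w) => xy yz zw wv.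
have h1 : `|x - v| <= `|x - y| + `|y - v| := ler_distD _ _ _.
have h2 : `|y - v| <= `|y - z| + `|z - v| := ler_distD _ _ _.
have h3 : `|z - v| <= `|z - w| + `|w - v| := ler_distD _ _ _.
by lra.
Qed.

Section RayLifting.
Variables (R : realType) (P : R * R -> R * R -> Prop) (d : R).
Hypothesis d0 : 0 < d.
Hypothesis P_separated : forall x e e' : R * R, P x e -> P x e' -> `|e - e'| < 4 * d -> e = e'.
Hypothesis P_step : forall eps : R, 0 < eps -> exists2 eta : R, 0 < eta &
  forall x x' e : R * R, P x e -> `|x' - x| < eta -> exists2 e', P x' e' & `|e' - e| < eps.
Variables x0 e0 : R * R.
Hypothesis Pe0 : P x0 e0.

Implicit Types (x e : R * R) (t : R) (N M i j : nat).

Let ray x t : R * R := x0 + t *: (x - x0).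

Let next e x' : R * R := xget e [set e' | P x' e' /\ `|e' - e| < d].

(** Here [P x e] is read as: [e] lies in the fibre over [x]. The fibre point is continued along the
    segment from [x0] to [x] in [N] steps. The default of [xget] in [next] does not occur once the
    steps are shorter than [eta]. *)
Fixpoint ray_point N x i : R * R :=
  if i is i'.+1 then next (ray_point N x i') (ray x (i%:R / N%:R)) else e0.

Let ray_dist x t t' : `|ray x t - ray x t'| = `|t - t'| * `|x - x0|.
Proof. by rewrite /ray opprD addrACA subrr add0r -scalerBl normrZ. Qed.

Variable eta : R.
Hypothesis eta0 : 0 < eta.
Hypothesis etaP : forall x x' e : R * R, P x e -> `|x' - x| < eta ->
  exists2 e', P x' e' & `|e' - e| < d.

Let good N x := `|x - x0| < eta * N%:R.

Let good_gt0 N x : good N x -> 0 < N%:R :> R.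
Proof. by move=> g; rewrite -(pmulr_rgt0 _ eta0); apply: le_lt_trans g. Qed.

Lemma ray_pointP N x i : good N x ->
  P (ray x (i%:R / N%:R)) (ray_point N x i) /\
  `|ray_point N x i.+1 - ray_point N x i| < d.
Proof.
move=> g; have N0 := good_gt0 g.
have small j : `|ray x (j.+1%:R / N%:R) - ray x (j%:R / N%:R)| < eta.
  rewrite ray_dist -mulrBl -natr1 addrAC subrr add0r mul1r ger0_norm ?invr_ge0 ?ltW//.
  by rewrite mulrC ltr_pdivrMr.
have step j : P (ray x (j%:R / N%:R)) (ray_point N x j) ->
    P (ray x (j.+1%:R / N%:R)) (ray_point N x j.+1) /\
    `|ray_point N x j.+1 - ray_point N x j| < d.
  move=> Pj; have [e' Pe' e'd] := etaP Pj (small j).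
  exact: (@xgetPex _ _ [set e' | P _ e' /\ `|e' - _| < d] (ex_intro _ e' (conj Pe' e'd))).
suff Pi : P (ray x (i%:R / N%:R)) (ray_point N x i) by split; last by case: (step _ Pi).
elim: i => [|i IH]; first by rewrite mul0r /ray scale0r addr0.
by case: (step _ IH).
Qed.

(** The fine sequence stays within [d] of the coarse point while it runs through one coarse step, so
    separation of the fibre makes the two agree at the next coarse node. *)
Lemma ray_point_refine N M x : good N x -> (0 < M)%N ->
  ray_point N x N = ray_point (N * M) x (N * M).
Proof.
move=> g M0; have N0 := good_gt0 g.
have M0' : 0 < M%:R :> R by rewrite ltr0n.
have g' : good (N * M) x.
  apply: lt_le_trans g _; rewrite ler_pM2l// ler_nat.
  by rewrite leq_pmulr.
have scale i : (i * M)%:R / (N * M)%:R = i%:R / N%:R :> R.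
  by rewrite !natrM invfM mulrACA divff ?mulr1// gt_eqF.
suff H i : ray_point N x i = ray_point (N * M) x (i * M) by [].
elim: i => [//|i IH].
have near_i j : (j <= M)%N ->
    `|ray_point (N * M) x (i * M + j) - ray_point N x i| < d.
  elim: j => [_|j IHj jM]; first by rewrite addn0 -IH subrr normr0.
  have [Pi _] := ray_pointP i g.
  have close : `|ray x ((i * M + j.+1)%:R / (N * M)%:R) - ray x (i%:R / N%:R)| < eta.
    rewrite ray_dist natrD mulrDl scale addrAC subrr add0r.
    rewrite ger0_norm ?divr_ge0//; apply: (@le_lt_trans _ _ (N%:R^-1 * `|x - x0|)).
      rewrite ler_wpM2r// natrM invfM [N%:R^-1 * _]mulrC mulrA.
      by rewrite ler_piMl ?invr_ge0// ler_pdivrMr// mul1r ler_nat.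
    by rewrite mulrC ltr_pdivrMr.
  have [e' Pe' e'd] := etaP Pi close.
  have [Pj1 _] := ray_pointP (i * M + j.+1) g'.
  have [_ dj] := ray_pointP (i * M + j) g'.
  have {}IHj := IHj (ltnW jM).
  rewrite -(P_separated Pe' Pj1)//; rewrite addnS.
  by apply: (plane_dist4 e'd IHj dj); rewrite subrr normr0.
have [Pi1 _] := ray_pointP i.+1 g.
have [Pi2 _] := ray_pointP (i.+1 * M) g'; rewrite scale in Pi2.
apply: (P_separated Pi1 Pi2).
have := near_i M (leqnn M); rewrite -mulSnr => d2.
have [_ d1] := ray_pointP i g.
by apply: (@plane_dist4 _ _ _ (ray_point (N * M) x (i.+1 * M)) _ _ _ d1 d2); rewrite subrr normr0.
Qed.

(** Origin of [4 * d]: from the fibre point that [P_step] gives over the new node to the continued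
    one there are four jumps below [d], through point [i.+1] over [x], point [i] over [x] and point
    [i] over [x']. *)
Lemma ray_point_continuous N x i eps : (i <= N)%N -> good N x -> 0 < eps ->
  exists2 r, 0 < r & forall x', good N x' -> `|x' - x| < r ->
    `|ray_point N x' i - ray_point N x i| < eps.
Proof.
move=> + g; elim: i eps => [|i IH] eps iN eps0.
  by exists 1 => // x' _ _; rewrite subrr normr0.
have [r1 r10 r1P] := IH d (ltnW iN) d0.
have m0 : 0 < Num.min eps d by rewrite lt_min eps0.
have [r2 r20 r2P] := P_step m0.
exists (Num.min r1 r2); first by rewrite lt_min r10.
move=> x' g'; rewrite lt_min => /andP[x'1 x'2].
have [Pi _] := ray_pointP i.+1 g; have [Pi' _] := ray_pointP i.+1 g'.
have close : `|ray x' (i.+1%:R / N%:R) - ray x (i.+1%:R / N%:R)| < r2.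
  apply: le_lt_trans x'2.
  rewrite /ray opprD addrACA subrr add0r -scalerBr normrZ opprB addrA subrK.
  rewrite ger0_norm ?divr_ge0// ler_piMl// ler_pdivrMr ?mul1r ?ler_nat//.
  exact: good_gt0 g.
have [e' Pe'] := r2P _ _ _ Pi close; rewrite lt_min => /andP[e'eps e'd].
rewrite -(P_separated Pe' Pi')//.
have [_ d1] := ray_pointP i g; have [_ d2] := ray_pointP i g'.
have d3 := r1P _ g' x'1.
apply: (@plane_dist4 _ (ray_point N x i.+1) (ray_point N x i) (ray_point N x' i)) => //.
- by rewrite distrC.
- by rewrite distrC.
Qed.

Definition ray_lift x := let N := (Num.truncn (`|x - x0| / eta)).+1 in ray_point N x N.

Let good_lift x : good (Num.truncn (`|x - x0| / eta)).+1 x.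
Proof. by rewrite /good mulrC -ltr_pdivrMr// truncnS_gt. Qed.

(** Two admissible subdivisions have a common refinement. Hence one [N] serves all points near a
    given one, as continuity requires. *)
Lemma ray_liftE N x : good N x -> ray_lift x = ray_point N x N.
Proof.
move=> g; rewrite (ray_point_refine g (ltn0Sn (Num.truncn (`|x - x0| / eta)))).
rewrite /ray_lift (@ray_point_refine _ N x (good_lift x)) ?(mulnC N)//.
by have := good_gt0 g; rewrite ltr0n.
Qed.

Lemma ray_liftP : [/\ continuous ray_lift, forall x, P x (ray_lift x) & ray_lift x0 = e0].
Proof.
split.
- apply/plane_continuousP => x eps eps0.
  (* The added 1 makes [N] admissible on the whole unit disk about [x]. *)
  pose N := (Num.truncn ((`|x - x0| + 1) / eta)).+1.
  have gN : `|x - x0| + 1 < eta * N%:R by rewrite mulrC -ltr_pdivrMr// truncnS_gt.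
  have g : good N x by apply: lt_trans gN; rewrite ltrDl.
  have [r r0 rP] := ray_point_continuous (leqnn N) g eps0.
  exists (Num.min r 1); first by rewrite lt_min r0/=.
  move=> x'; rewrite lt_min => /andP[x'r x'1].
  have g' : good N x'.
    by apply: le_lt_trans (ler_distD x _ _) (lt_trans _ gN); rewrite addrC ltrD2l.
  by rewrite (ray_liftE g) (ray_liftE g'); apply: rP.
- move=> x; have g := good_lift x; rewrite (ray_liftE g).
  have [+ _] := ray_pointP (Num.truncn (`|x - x0| / eta)).+1 g.
  by rewrite divff ?pnatr_eq0// /ray scale1r addrC subrK.
- have g : good 1 x0 by rewrite /good subrr normr0 mulr1.
  rewrite (ray_liftE g); have [P1 _] := ray_pointP 1 g; have [_ d1] := ray_pointP 0 g.
  rewrite divr1 /ray subrr scaler0 addr0 in P1.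
  apply: (P_separated P1 Pe0); apply: lt_le_trans d1 _.
  by move: d0; lra.
Qed.

End RayLifting.

(** Covering space lifting for uniformly discrete fibres, along straight segments. The fibres of
    [tpi] will give the lift of f, those of the lift its continuous sections. *)
Lemma uniform_fiber_lift (R : realType) (P : R * R -> R * R -> Prop) (d : R) (x0 e0 : R * R) :
  0 < d ->
  (forall x e e' : R * R, P x e -> P x e' -> `|e - e'| < 4 * d -> e = e') ->
  (forall eps : R, 0 < eps -> exists2 eta : R, 0 < eta &
    forall x x' e : R * R, P x e -> `|x' - x| < eta -> exists2 e', P x' e' & `|e' - e| < eps) ->
  P x0 e0 ->
  exists L : R * R -> R * R, [/\ continuous L, forall x, P x (L x) & L x0 = e0].
Proof.
move=> d0 sep step Pe0; have [eta eta0 etaP] := step _ d0.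
exists (ray_lift P d x0 e0 eta); exact: ray_liftP.
Qed.

(** * Stabilizers in the integer lattice *)

Section IntegerLattice.
Implicit Types (A B M : 'M[int]_2) (v w : 'cV[int]_2).

Lemma mulmx_cV2 (T : comNzRingType) (A : 'M[T]_2) (k : 'cV[T]_2) i :
  (A *m k) i 0 = A i 0 * k 0 0 + A i 1 * k 1 0.
Proof.
rewrite mxE !big_ord_recl big_ord0 addr0 /= (_ : lift ord0 ord0 = 1)//.
exact/val_inj.
Qed.

Lemma mulmx_rV2 (T : comNzRingType) (l : 'rV[T]_2) (A : 'M[T]_2) i :
  (l *m A) 0 i = l 0 0 * A 0 i + l 0 1 * A 1 i.
Proof.
rewrite mxE !big_ord_recl big_ord0 addr0 /= (_ : lift ord0 ord0 = 1)//.
exact/val_inj.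
Qed.

Lemma det2 (T : comNzRingType) (A : 'M[T]_2) : \det A = A 0 0 * A 1 1 - A 0 1 * A 1 0.
Proof.
rewrite (expand_det_row _ ord0) !big_ord_recl big_ord0 addr0 /cofactor !det_mx11 !mxE.
have -> : lift ord0 ord0 = 1 :> 'I_2 by apply/val_inj.
have -> : lift (1 : 'I_2) (0 : 'I_1) = 0 by apply/val_inj.
by rewrite expr0 expr1 mul1r mulN1r mulrN.
Qed.

Lemma ord2P (i : 'I_2) : i = 0 \/ i = 1.
Proof. by case: i => [[|[|//]]] p; [left|right]; apply/val_inj. Qed.

Lemma cV2P (T : nmodType) (v w : 'cV[T]_2) : v 0 0 = w 0 0 -> v 1 0 = w 1 0 -> v = w.
Proof.
move=> h0 h1; apply/matrixP => i j; rewrite (ord1 j).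
by case: (ord2P i) => ->.
Qed.

Definition cV2 (T : nmodType) (a b : T) : 'cV[T]_2 := \col_i (if i == 0 then a else b).

Lemma cV2_0 (T : nmodType) (a b : T) : cV2 a b 0 0 = a. Proof. by rewrite mxE. Qed.
Lemma cV2_1 (T : nmodType) (a b : T) : cV2 a b 1 0 = b. Proof. by rewrite mxE. Qed.

Definition cross v w : int := v 0 0 * w 1 0 - v 1 0 * w 0 0.

Lemma crossB v w w' : cross v (w - w') = cross v w - cross v w'.
Proof. by rewrite /cross !mxE; ring. Qed.

Lemma cross_mulmx B v w : cross (B *m v) (B *m w) = \det B * cross v w.
Proof. by rewrite /cross !mulmx_cV2 det2; ring. Qed.

(* A power of [A] and hence [A] itself has the left eigenvector [l]: were [l] and
   [l A] independent, the power would be a scalar matrix of determinant one. *)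
Lemma eigenvalue_of_power (R : realType) A n (l : 'rV[int]_2) (s : int) :
  1 < `|\det A| -> (0 < n)%N -> l != 0 -> `|s| = 1 -> l *m (A ^+ n) = s *: l ->
  exists mu : R, `|mu| = 1 /\ eigenvalue (map_mx intr A) mu.
Proof.
move=> dA n0 l0 s1 lA.
have s2 : s * s = 1 by rewrite -expr2 -real_normK ?num_real// s1 expr1n.
have detM : l 0 0 * (l *m A) 0 1 - l 0 1 * (l *m A) 0 0 = 0.
  pose M : 'M[int]_2 := \matrix_(i, j) (if i == 0 then l 0 j else (l *m A) 0 j).
  have rowM0 : row 0 M = l by apply/rowP => j; rewrite !mxE.
  have rowM1 : row 1 M = l *m A by apply/rowP => j; rewrite !mxE.
  have MB : M *m (A ^+ n) = s *: M.
    apply/row_matrixP => i; rewrite row_mul linearZ /=.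
    case: (ord2P i) => ->; rewrite ?rowM0 ?rowM1 //.
    rewrite -mulmxA (_ : A *m A ^+ n = A ^+ n *m A); last exact: commrX.
    by rewrite mulmxA lA scalemxAl.
  have := congr1 determinant MB; rewrite det_mulmx detZ expr2 s2 mul1r.
  have -> : \det M = l 0 0 * (l *m A) 0 1 - l 0 1 * (l *m A) 0 0.
    by rewrite det2 !mxE.
  move=> /eqP; rewrite -subr_eq0 -[X in _ - X]mulr1 -mulrBr mulf_eq0.
  case/orP => [/eqP//|]; rewrite subr_eq0 => /eqP dB.
  have := congr1 Num.norm dB; rewrite (_ : \det (A ^+ n) = \det A ^+ n); last first.
    by elim: n {n0 lA MB dB} => [|n IH]; rewrite ?det1// !exprS det_mulmx IH.
  rewrite normrX normr1 => /eqP; rewrite pexpr_eq1// => /eqP h.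
  by rewrite h ltxx in dA.
pose lR : 'rV[R]_2 := map_mx intr l.
pose AR : 'M[R]_2 := map_mx intr A.
have lR0 : lR != 0.
  apply: contra l0 => /eqP h; apply/eqP/rowP => j.
  have := congr1 (fun M : 'rV_2 => M 0 j) h; rewrite !mxE => /eqP.
  by rewrite intr_eq0 => /eqP.
have [mu lmu] : exists mu : R, lR *m AR = mu *: lR.
  have detR : lR 0 0 * (lR *m AR) 0 1 - lR 0 1 * (lR *m AR) 0 0 = 0.
    have := congr1 (fun z : int => z%:~R : R) detM.
    by rewrite /lR /AR -map_mxM !mxE rmorphB !rmorphM /=.
  have [l00|l00] := eqVneq (lR 0 0) 0.
    have l01 : lR 0 1 != 0.
      apply: contra lR0 => /eqP h; apply/eqP/rowP => j; rewrite [RHS]mxE.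
      by case: (ord2P j) => ->.
    exists ((lR *m AR) 0 1 / lR 0 1); apply/rowP => j; rewrite [RHS]mxE.
    case: (ord2P j) => ->; last by rewrite divfK.
    move: detR; rewrite l00 mul0r sub0r mulr0 => /eqP.
    by rewrite oppr_eq0 mulf_eq0 (negbTE l01) => /eqP.
  exists ((lR *m AR) 0 0 / lR 0 0); apply/rowP => j; rewrite [RHS]mxE.
  case: (ord2P j) => ->; first by rewrite divfK.
  move/eqP: detR; rewrite subr_eq0 => /eqP h.
  by apply: (mulfI l00); rewrite h; field.
exists mu; split; last by apply/eigenvalueP; exists lR.
have lmun (k : nat) : lR *m AR ^+ k = mu ^+ k *: lR.
  elim: k => [|k IH]; first by rewrite !expr0 mulmx1 scale1r.
  by rewrite exprS mulmxA lmu -scalemxAl IH scalerA -exprS.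
have mun : mu ^+ n = s%:~R.
  have : (mu ^+ n - s%:~R) *: lR = 0.
    rewrite scalerBl -lmun /AR -rmorphXn /= -map_mxM lA.
    by apply/eqP; rewrite subr_eq0; apply/eqP/rowP => j; rewrite !mxE rmorphM.
  by move/eqP; rewrite scaler_eq0 (negbTE lR0) orbF subr_eq0 => /eqP.
have : `|mu| ^+ n = 1 by rewrite -normrX mun -intr_norm s1.
by move/eqP; rewrite pexpr_eq1// => /eqP.
Qed.

Lemma int_minimal (T : Type) (g : T -> int) : (exists x, g x != 0) ->
  exists2 x, g x != 0 & forall y, g y != 0 -> `|g x| <= `|g y|.
Proof.
move=> [x gx].
have ex : exists n, `[< exists2 y, g y != 0 & `|g y|%N = n >].
  by exists `|g x|%N; apply/asboolP; exists x.
case: (ex_minnP ex) => n /asboolP[y gy yn] min; exists y => // z gz.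
by rewrite -!abszE lez_nat yn; apply: min; apply/asboolP; exists z.
Qed.

Lemma int_mul_neq1 (a b : int) : 1 < a -> 0 <= b -> a * b = 1 -> False.
Proof.
move=> a1 b0 ab; have [b1|b1] : b = 0 \/ 1 <= b by lia.
  by move: ab; rewrite b1 mulr0.
by have := ler_peMr (ltW (lt_trans ltr01 a1)) b1; rewrite ab; lia.
Qed.

Lemma int_sqr_factor (a b c : int) :
  0 < a -> a <= b -> a <= c -> a * a = b * c -> b = a.
Proof.
move=> a0 ab ac h; apply/eqP; rewrite eq_le ab andbT -(ler_pM2r a0) h.
by rewrite ler_wpM2l// (le_trans (ltW a0)).
Qed.

Section Stabilizer.
Variables (A : 'M[int]_2) (n : nat) (H : 'cV[int]_2 -> Prop).
Hypothesis detA : 1 < `|\det A|.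
Hypothesis n_gt0 : (0 < n)%N.
Hypothesis H0 : H 0.
Hypothesis HB : forall v w, H v -> H w -> H (v - w).
Hypothesis H_stable : forall v, H v -> H (A ^+ n *m v).
Hypothesis H_cofinal : forall w, exists v, H (w - A ^+ n *m v).

Let det_pow : 1 < `|\det (A ^+ n)|.
Proof.
have -> : \det (A ^+ n) = \det A ^+ n.
  by elim: n => [|k IH]; rewrite ?det1// !exprS det_mulmx IH.
by rewrite normrX exprn_egt1// -lt0n.
Qed.

Let HN v : H v -> H (- v).
Proof. by move=> Hv; rewrite -sub0r; apply: HB. Qed.

Let HD v w : H v -> H w -> H (v + w).
Proof. by move=> Hv /HN Hw; rewrite -[w]opprK; apply: HB. Qed.

Let HZ (z : int) v : H v -> H (z *: v).
Proof.
move=> Hv; rewrite -[z]intz scaler_int.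
have Hn k : H (v *+ k) by elim: k => [|k IH]; rewrite ?mulr0n// mulrS; apply: HD.
by case: z => k; [exact: Hn|rewrite NegzE mulrNz; apply: HN; exact: Hn].
Qed.

(* The functional [cross v] spans the annihilator of a rank one [H]; the
   induced map on the quotient is onto, hence multiplication by a unit. *)
Lemma stabilizer_dichotomy (R : realType) :
  (exists mu : R, `|mu| = 1 /\ eigenvalue (map_mx intr A) mu) \/
  exists2 N : int, 0 < N & H (cV2 N 0) /\ H (cV2 0 N).
Proof.
have [[v [w [Hv [Hw vw]]]]|rank1] :=
    pselect (exists v w, H v /\ H w /\ cross v w != 0).
  (* Cramer's rule: [cross v w] times a basis vector is an integer combination of [v] and [w]. *)
  right; exists `|cross v w|; first by rewrite normr_gt0.
  have Hs a b : H (cV2 a b) -> H (cV2 (Num.sg (cross v w) * a) (Num.sg (cross v w) * b)).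
    move=> /(HZ (Num.sg (cross v w))); congr H.
    by apply: cV2P; rewrite !mxE.
  rewrite normrEsg; split; rewrite -[0](mulr0 (Num.sg (cross v w))); apply: Hs.
    rewrite (_ : cV2 _ _ = w 1 0 *: v - v 1 0 *: w).
      by apply: HB; apply: HZ.
    by apply: cV2P; rewrite ?cV2_0 ?cV2_1 !mxE /cross; ring.
  rewrite (_ : cV2 _ _ = v 0 0 *: w - w 0 0 *: v).
    by apply: HB; apply: HZ.
  by apply: cV2P; rewrite ?cV2_0 ?cV2_1 !mxE /cross; ring.
left.
have {}rank1 v w : H v -> H w -> cross v w = 0.
  by move=> Hv Hw; apply: contrapT => /eqP vw; apply: rank1; exists v, w.
(* If [H] were zero, both basis vectors would be in the image of [A ^+ n], whose determinant would
   then divide 1. *)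
have [v Hv v0] : exists2 v, H v & v != 0.
  apply: contrapT => noV.
  have HE v : H v -> v = 0.
    by move=> Hv; apply: contrapT => /eqP v0; apply: noV; exists v.
  have [m1 /HE/eqP] := H_cofinal (cV2 1 0); rewrite subr_eq0 => /eqP e1.
  have [m2 /HE/eqP] := H_cofinal (cV2 0 1); rewrite subr_eq0 => /eqP e2.
  have : cross (cV2 1 0) (cV2 0 1) = 1 by rewrite /cross !cV2_0 !cV2_1.
  rewrite e1 e2 cross_mulmx => /(congr1 Num.norm); rewrite normrM normr1 => h.
  exact: (int_mul_neq1 det_pow (normr_ge0 _) h).
set B := A ^+ n.
(* A least nonzero value of the functional replaces a generator of its image: [sq] writes its square
   as a product of two values that are at least as large in modulus, so these have the same
   modulus. *)
have [w0 w00 w0min] : exists2 w, cross v w != 0 &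
    forall w', cross v w' != 0 -> `|cross v w| <= `|cross v w'|.
  apply: int_minimal; apply: contrapT => h; move/negP: v0; apply; apply/eqP.
  have h0 w : cross v w = 0 by apply: contrapT => /eqP hw; apply: h; exists w.
  apply: cV2P; rewrite [RHS]mxE.
    by have := h0 (cV2 0 1); rewrite /cross cV2_0 cV2_1 mulr1 mulr0 subr0.
  by have /eqP := h0 (cV2 1 0); rewrite /cross cV2_0 cV2_1 mulr0 mulr1 sub0r oppr_eq0 => /eqP.
have Bv : cross v (B *m v) = 0 by apply: rank1 => //; exact: H_stable.
(* [B] preserves the kernel of [cross v], so it acts on the values of this functional by a common
   ratio. *)
have prop w w' : cross v (B *m w) * cross v w' = cross v (B *m w') * cross v w.
  have -> : cross v (B *m w) * cross v w' =
      cross v (B *m w') * cross v w + cross v (B *m v) * cross w w'.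
    by rewrite /cross !mulmx_cV2; ring.
  by rewrite Bv mul0r addr0.
have [w1 Hw1] := H_cofinal w0.
have ew1 : cross v w0 = cross v (B *m w1).
  by apply/eqP; rewrite -subr_eq0 -crossB; apply/eqP/rank1.
have sq : cross v w0 * cross v w0 = cross v (B *m w0) * cross v w1.
  by rewrite {1}ew1 prop.
have [p1 p2] : cross v (B *m w0) != 0 /\ cross v w1 != 0.
  apply/andP; rewrite -negb_or -mulf_eq0 -sq mulf_eq0 negb_or.
  by rewrite w00.
have abs_eq : `|cross v (B *m w0)| = `|cross v w0|.
  have h1 := w0min _ p1; have h2 := w0min _ p2.
  have := congr1 Num.norm sq; rewrite !normrM => h3.
  have h0 : 0 < `|cross v w0| by rewrite normr_gt0.
  exact: int_sqr_factor h0 h1 h2 h3.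
have [s s1 es] : exists2 s : int, `|s| = 1 & cross v (B *m w0) = s * cross v w0.
  move/eqP: abs_eq; rewrite eqr_norm2 => /orP[]/eqP ->.
    by exists 1; rewrite ?mul1r.
  by exists (-1); rewrite ?mulN1r.
have Bs w : cross v (B *m w) = s * cross v w.
  by apply: (mulIf w00); rewrite prop es mulrAC.
(* The row vector of the functional [cross v]; [Bs] says that it is a left eigenvector of [B]. *)
pose l : 'rV[int]_2 := \row_j (if j == 0 then - v 1 0 else v 0 0).
have l0 : l != 0.
  apply: contra v0 => /eqP h; apply/eqP/cV2P; rewrite [RHS]mxE.
    by have := congr1 (fun M : 'rV_2 => M 0 1) h; rewrite !mxE.
  have /eqP := congr1 (fun M : 'rV_2 => M 0 0) h; rewrite !mxE /= oppr_eq0.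
  by move/eqP.
apply: (eigenvalue_of_power R detA n_gt0 l0 s1).
apply/rowP => j; rewrite mulmx_rV2 !mxE /= -/B.
case: (ord2P j) => -> /=.
  have := Bs (cV2 1 0); rewrite /cross !mulmx_cV2 cV2_0 cV2_1 => h.
  by rewrite mulrN addrC !mulr0 !mulr1 !addr0 in h *; rewrite mulNr h; ring.
have := Bs (cV2 0 1); rewrite /cross !mulmx_cV2 cV2_0 cV2_1 => h.
by rewrite !mulr0 !mulr1 !add0r in h *; rewrite addrC mulNr h; ring.
Qed.

End Stabilizer.
End IntegerLattice.

(** * The torus as a quotient of the plane *)

Lemma connected_clopen (T : topologicalType) (S Z : set T) : connected S ->
  (exists x, S x /\ Z x) -> (forall x, S x -> Z x -> nbhs x Z) ->
  (forall x, S x -> ~ Z x -> nbhs x (~` Z)) -> S `<=` Z.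
Proof.
move=> Sc [x0 [Sx0 Zx0]] Zo Zc; rewrite -setIidPl; apply: Sc.
- by exists x0.
- exists Z°; first exact: open_interior.
  apply/seteqP; split=> x [Sx Zx]; split=> //; first exact: Zo.
  exact: interior_subset.
- exists (~` (~` Z)°); first by rewrite closedC; exact: open_interior.
  apply/seteqP; split=> x [Sx Zx]; split=> //.
    by move=> /interior_subset; apply.
  by apply: contrapT => nZx; apply: Zx; exact: Zc.
Qed.

Section PlaneConnected.
Variable R : realType.

Lemma star_connected (S : set (R * R)) (p : R * R) : S p ->
  (forall x t, S x -> 0 <= t <= 1 -> S (p + t *: (x - p))) -> connected S.
Proof.
move=> Sp Sstar.
have -> : S = \bigcup_(x in S) ((fun t : R => p + t *: (x - p)) @` `[0, 1]).
  apply/seteqP; split=> x.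
    move=> Sx; exists x => //; exists 1; first by rewrite /= in_itv/= ler01 lexx.
    by rewrite scale1r addrC subrK.
  by move=> [y Sy [t /=]]; rewrite in_itv/= => t01 <-; apply: Sstar.
apply: bigcup_connected => [|x Sx].
  exists p => x Sx; exists 0; first by rewrite /= in_itv/= lexx ler01.
  by rewrite scale0r addr0.
apply: connected_continuous_connected; first exact: segment_connected.
apply: continuous_subspaceT => t.
by apply: cvgD; [exact: cvg_cst|apply: cvgZr_tmp; exact: cvg_id].
Qed.

Lemma plane_connected : connected [set: R * R].
Proof. exact: (@star_connected _ 0). Qed.

Lemma disk_connected (x : R * R) (r : R) : 0 < r -> connected [set y | `|y - x| < r].
Proof.
move=> r0; apply: (@star_connected _ x); first by rewrite /= subrr normr0.
move=> y t /= yx /andP[t0 t1]; rewrite addrC addKr normrZ ger0_norm//.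
by apply: le_lt_trans yx; rewrite ler_piMl.
Qed.

Lemma component_open (S : set (R * R)) x : open S -> open (connected_component S x).
Proof.
move=> So; apply/plane_openP => y Sxy.
have /(@plane_openP R)/(_ y (connected_component_sub Sxy))[r r0 rS] := So.
exists r => // z zy; apply: connected_component_trans Sxy _.
apply: (@connected_component_max _ _ [set z | `|z - y| < r]) => //=.
- by rewrite subrr normr0.
- exact: disk_connected.
Qed.

End PlaneConnected.

Section Torus.
Variable R : realType.
Implicit Types (x y z : R * R) (k : 'cV[int]_2) (S : set (R * R)).

Definition zvec k : R * R := ((k 0 0)%:~R, (k 1 0)%:~R).

Lemma zvecD k k' : zvec (k + k') = zvec k + zvec k'.
Proof. by rewrite /zvec !mxE !intrD. Qed.

Lemma zvecN k : zvec (- k) = - zvec k.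
Proof. by rewrite /zvec !mxE !intrN. Qed.

Lemma zvecB k k' : zvec (k - k') = zvec k - zvec k'.
Proof. by rewrite zvecD zvecN. Qed.

Lemma zvec0 : zvec 0 = 0.
Proof. by rewrite /zvec !mxE. Qed.

Lemma zvec_small k : `|zvec k| < 1 -> k = 0.
Proof.
rewrite norm_pair_lt /= -!intr_norm -[1]/(1%:~R) !ltr_int => /andP[h0 h1].
have aux (a : int) : `|a| < 1 -> a = 0.
  by rewrite -abszE ltz_nat ltnS leqn0 absz_eq0 => /eqP.
by apply: cV2P; rewrite [RHS]mxE; exact: aux.
Qed.

Lemma tpi_eqP x y : tpi x = tpi y <-> exists k, x = y + zvec k.
Proof.
rewrite /tpi; split.
  move/(@eqmodP _ (zeq_equiv R)) => /andP[/intrP[a ha] /intrP[b hb]].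
  exists (cV2 a b); rewrite /zvec cV2_0 cV2_1 -ha -hb.
  by case: x y {ha hb} => [x1 x2] [y1 y2]; congr pair => /=; rewrite addrC subrK.
move=> [k ->]; apply/(@eqmodP _ (zeq_equiv R)).
by apply/andP; split; rewrite /= addrAC subrr add0r intr_int.
Qed.

Lemma tpiD x k : tpi (x + zvec k) = tpi x.
Proof. by apply/tpi_eqP; exists k. Qed.

Lemma treprK p : tpi (trepr p) = p :> torus R.
Proof. exact: reprK. Qed.

Lemma tpi_surj p : exists x, tpi x = p :> torus R.
Proof. by exists (trepr p); rewrite treprK. Qed.

Lemma torus_openE (B : set (torus R)) : open B = open (@tpi R @^-1` B).
Proof. by []. Qed.

Lemma tpi_continuous : continuous (@tpi R).
Proof. exact: pi_continuous. Qed.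

Definition periodic S := forall x k, S x -> S (x + zvec k).

Lemma periodicP S x k : periodic S -> S (x + zvec k) <-> S x.
Proof.
by move=> Sp; split=> [/(Sp _ (- k))|/Sp //]; rewrite zvecN addrK.
Qed.

Lemma preimage_tpi_image S : @tpi R @^-1` (@tpi R @` S) = [set x | exists k, S (x + zvec k)].
Proof.
apply/seteqP; split=> x /=.
  by move=> [y Sy /tpi_eqP[k e]]; exists k; rewrite -e.
by move=> [k Sxk]; exists (x + zvec k) => //; rewrite tpiD.
Qed.

Lemma periodic_image S : periodic S -> @tpi R @^-1` (@tpi R @` S) = S.
Proof.
move=> Sp; rewrite preimage_tpi_image; apply/seteqP; split=> x /=.
  by move=> [k]; rewrite (periodicP x k Sp).
by move=> Sx; exists 0; rewrite zvec0 addr0.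
Qed.

Lemma open_shift S v : open S -> open [set x | S (x + v)].
Proof.
move=> /plane_openP So; apply/plane_openP => x /= /So[r r0 rS]; exists r => // y yx.
by apply: rS; rewrite opprD addrACA subrr addr0.
Qed.

Lemma tpi_open S : open S -> open (@tpi R @` S).
Proof.
move=> So; rewrite torus_openE preimage_tpi_image.
have -> : [set x | exists k, S (x + zvec k)] = \bigcup_k [set x | S (x + zvec k)].
  by apply/seteqP; split=> x /= [k]; [exists k|exists k].
by apply: bigcup_open => k _; exact: open_shift.
Qed.

Lemma floor_zvec x : exists k, 0 <= (x + zvec k).1 < 1 /\ 0 <= (x + zvec k).2 < 1.
Proof.
exists (cV2 (- Num.floor x.1) (- Num.floor x.2)).
rewrite /zvec cV2_0 cV2_1 !intrN /=.
have fl (a : R) : 0 <= a - (Num.floor a)%:~R < 1.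
  by rewrite subr_ge0 floor_le_tmp ltrBlDr addrC -intrD1 floorD1_gt.
by split; exact: fl.
Qed.

(* By compactness of the fundamental domain. *)
Lemma uniform_periodic (Q : R -> R * R -> Prop) :
  (forall r r' x, 0 < r' -> r' <= r -> Q r x -> Q r' x) ->
  (forall r x k, Q r x -> Q r (x + zvec k)) ->
  (forall x, exists2 r : R, 0 < r & forall y, `|y - x| < r -> Q r y) ->
  exists2 r : R, 0 < r & forall x, Q r x.
Proof.
move=> Qmono Qper Qloc.
pose K : set (R * R) := `[0, 1]%classic `*` `[0, 1]%classic.
have : compact K by apply: compact_setX; exact: segment_compact.
rewrite compact_near_coveringP => /(_ R (0^'+) (fun r x => Q r x) _) covK.
have KQ : \forall r \near 0^'+, K `<=` Q r.
  apply: covK => x _; have [r r0 rQ] := Qloc x.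
  exists ([set y | `|y - x| < r], [set s | 0 < s < r]) => /=.
    split; first by apply/plane_nbhsP; exists r.
    near=> s; apply/andP; split; near: s.
      exact: nbhs_right_gt.
    exact: nbhs_right_lt.
  by move=> [y s] [/= yx /andP[s0 sr]]; apply: (Qmono r) (rQ _ yx) => //; exact: ltW.
have [r [r0 rK]] : exists r, 0 < r /\ K `<=` Q r.
  near (0 : R)^'+ => r; exists r; split; first by near: r; exact: nbhs_right_gt.
  by near: r.
exists r => // x; have [k [k1 k2]] := floor_zvec x.
have : Q r (x + zvec k).
  by apply: rK; split; rewrite /= in_itv/=; [move: k1|move: k2] => /andP[-> /ltW].
by move=> /(Qper _ _ (- k)); rewrite zvecN addrK.
Unshelve. all: by end_near.
Qed.

Lemma lattice_valued_const (g : R * R -> R * R) : continuous g ->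
  (forall x, exists k, g x = zvec k) -> forall x y, g x = g y.
Proof.
move=> /plane_continuousP gc gZ x y.
suff : [set: R * R] `<=` [set z | g z = g y] by apply.
have near_eq z : exists2 r : R, 0 < r & forall w, `|w - z| < r -> g w = g z.
  have [r r0 rg] := gc z 1 ltr01; exists r => // w /rg.
  have [k ->] := gZ w; have [k' ->] := gZ z.
  by rewrite -zvecB => /zvec_small/eqP; rewrite subr_eq0 => /eqP ->.
apply: connected_clopen; first exact: plane_connected.
- by exists y.
- move=> z _ /= gz; have [r r0 rg] := near_eq z.
  by apply/plane_nbhsP; exists r => // w /rg gw /=; rewrite gw.
- move=> z _ /= gz; have [r r0 rg] := near_eq z.
  by apply/plane_nbhsP; exists r => // w /rg gw /=; rewrite gw.
Qed.

End Torus.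

(** * The lift of a local homeomorphism *)

Section Lift.
Variable R : realType.
Implicit Types (x y z e : R * R) (k : 'cV[int]_2) (S : set (R * R)).

Lemma torus_lift (f : torus R -> torus R) : continuous f ->
  exists F : R * R -> R * R, continuous F /\ forall x, tpi (F x) = f (tpi x).
Proof.
move=> fc.
have fpc : continuous (f \o @tpi R).
  by move=> x; apply: continuous_comp; [exact: tpi_continuous|exact: fc].
have [e0 He0] := tpi_surj (f (tpi 0)).
(* The fibre over [x] is the lattice coset above [f (tpi x)]. Its distinct points are at distance at
   least 1, which is four times the constant 1/4. *)
have [| | | |F [Fc FP _]] := @uniform_fiber_lift R
  (fun x e => tpi e = f (tpi x)) 4^-1 0 e0; last by exists F.
- by rewrite invr_gt0.
- move=> x e e' He He'; have /tpi_eqP[k ->] : tpi e = tpi e' by rewrite He He'.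
  by rewrite mulfV// addrAC subrr add0r => /zvec_small ->; rewrite zvec0 addr0.
- move=> eps eps0.
  have [r r0 rP] : exists2 r : R, 0 < r & forall x, forall x' e,
      tpi e = f (tpi x) -> `|x' - x| < r ->
      exists2 e', tpi e' = f (tpi x') & `|e' - e| < eps; last by exists r => // x; exact: rP.
  apply: uniform_periodic.
  + move=> r r' x r'0 rr xP x' e ex x'x; apply: xP => //.
    exact: lt_le_trans x'x rr.
  + move=> r x k xP x' e; rewrite tpiD => ex x'x.
    have [|e' e'x] := xP (x' - zvec R k) e ex; first by rewrite addrAC -addrA -opprD.
    by exists e' => //; rewrite e'x -zvecN tpiD.
  (* One lift [e] is enough for a bound on the whole fibre, since any other lift is treated by a
     lattice translation. *)
  + move=> x; have [e ex] := tpi_surj (f (tpi x)).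
    pose D := [set e' | `|e' - e| < eps / 2].
    have Do : open (@tpi R @` D).
      by apply: tpi_open; exact: disk_open.
    have /(fpc x)/plane_nbhsP[r r0 rD] : nbhs (f (tpi x)) (@tpi R @` D).
      apply: open_nbhs_nbhs; split=> //; exists e; last exact: ex.
      by rewrite /D /= subrr normr0 divr_gt0.
    exists (r / 2); first by rewrite divr_gt0.
    move=> y yx x' ey eyP x'y.
    have [|e1 /= e1D e1y] := rD y.
      by apply: lt_trans yx _; rewrite ltr_pdivrMr// ltr_pMr// ltr1n.
    have [|e2 /= e2D e2y] := rD x'.
      apply: le_lt_trans (ler_distD y _ _) _.
      by rewrite [ltRHS]splitr ltrD.
    have /tpi_eqP[k ek] : tpi ey = tpi e1 by rewrite eyP e1y.
    exists (e2 + zvec R k); first by rewrite tpiD.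
    rewrite ek opprD addrACA subrr addr0.
    apply: le_lt_trans (ler_distD e _ _) _.
    by rewrite (distrC e) [ltRHS]splitr ltrD.
- exact: He0.
Qed.

(** For fixed [k] the difference of [F (x + zvec R k)] and [F x] is continuous and lattice valued,
    hence constant. The columns of [A] are its values at the two basis vectors. *)
Lemma lift_equivariant (f : torus R -> torus R) (F : R * R -> R * R) :
  continuous F -> (forall x, tpi (F x) = f (tpi x)) ->
  exists A : 'M[int]_2, forall x k, F (x + zvec R k) = F x + zvec R (A *m k).
Proof.
move=> Fc FP.
have shift k : exists m, forall x, F (x + zvec R k) = F x + zvec R m.
  pose g x := F (x + zvec R k) - F x.
  have gZ x : exists m, g x = zvec R m.
    have /tpi_eqP[m e] : tpi (F (x + zvec R k)) = tpi (F x) by rewrite !FP tpiD.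
    by exists m; rewrite /g e addrAC subrr add0r.
  have gc : continuous g.
    move=> x; apply: cvgB; last exact: Fc.
    apply: (@continuous_comp _ _ _ (fun x => x + zvec R k) F); last exact: Fc.
    by apply: cvgD; [exact: cvg_id|exact: cvg_cst].
  have [m gm] := gZ 0; exists m => x.
  by rewrite -gm (lattice_valued_const gc gZ 0 x) /g [F x + _]addrC subrK.
have [a aP] := shift (cV2 1 0); have [b bP] := shift (cV2 0 1).
have multiples v w (c : int) : (forall x, F (x + zvec R v) = F x + zvec R w) ->
    forall x, F (x + zvec R (c *: v)) = F x + zvec R (c *: w).
  move=> vw.
  have nat_case (n : nat) x : F (x + zvec R (n%:Z *: v)) = F x + zvec R (n%:Z *: w).
    elim: n => [|n IH]; first by rewrite !scale0r !zvec0 !addr0.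
    by rewrite intS !scalerDl !scale1r !zvecD ![zvec R _ + zvec R (n%:Z *: _)]addrC !addrA vw IH.
  case: c => n x; first exact: nat_case.
  have := nat_case n.+1 (x + zvec R (Negz n *: v)).
  rewrite NegzE !scaleNr !zvecN subrK => ->.
  by rewrite addrK.
exists (\matrix_(i, j) (if j == 0 then a i 0 else b i 0)) => x k.
have -> : k = k 0 0 *: cV2 1 0 + k 1 0 *: cV2 0 1.
  by apply: cV2P; rewrite !mxE /= ?mulr1 ?mulr0 ?addr0 ?add0r.
rewrite zvecD addrA (multiples _ _ _ bP) (multiples _ _ _ aP) -addrA -zvecD.
congr (_ + zvec R _); apply: cV2P; rewrite mulmx_cV2 !mxE /=; ring.
Qed.

End Lift.

Section LiftProperties.
Variables (R : realType) (f : torus R -> torus R) (F : R * R -> R * R) (A : 'M[int]_2).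
Hypothesis f_homeo : local_homeo f.
Hypothesis F_cont : continuous F.
Hypothesis F_lift : forall x, tpi (F x) = f (tpi x).
Hypothesis F_equi : forall x k, F (x + zvec R k) = F x + zvec R (A *m k).

Lemma lift_locally_injective : exists2 r : R, 0 < r &
  forall x y z, `|y - x| < r -> `|z - x| < r -> F y = F z -> y = z.
Proof.
apply: uniform_periodic.
- move=> r r' x r'0 rr xP y z yx zx; apply: xP; exact: lt_le_trans rr.
- move=> r x k xP y z yx zx yz.
  have := xP (y - zvec R k) (z - zvec R k); rewrite !(addrAC _ (- zvec R k)) -!addrA -!opprD.
  move=> /(_ yx zx); rewrite -zvecN !F_equi yz => /(_ erefl).
  exact: addIr.
- move=> x; have [_ /(_ (tpi x))[U [Uo Ux Uinj _]]] := f_homeo.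
  have /tpi_continuous/plane_nbhsP[r r0 rU] : nbhs (tpi x) U by exact: open_nbhs_nbhs.
  (* The first bound keeps both points above [U]; the second keeps their distance below 1, so that
     they cannot differ by a nonzero lattice vector. *)
  pose s := Num.min (r / 2) 4^-1.
  have s0 : 0 < s by rewrite lt_min divr_gt0//= invr_gt0.
  have sr : s + s <= r by rewrite [leRHS]splitr lerD// ge_min lexx.
  have s4 : s <= 4^-1 by rewrite ge_min lexx orbT.
  exists s => // x' x'x y z yx' zx' Fyz.
  have near_x w : `|w - x'| < s -> U (tpi w).
    move=> wx; apply: rU; apply: le_lt_trans (ler_distD x' _ _) _.
    by apply: lt_le_trans sr; rewrite ltrD.
  have /tpi_eqP[k yk] : tpi y = tpi z.
    by apply: Uinj; rewrite ?inE; [exact: near_x|exact: near_x|rewrite -!F_lift Fyz].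
  have : `|zvec R k| < 1.
    have -> : zvec R k = (y - x') - (z - x') by rewrite yk opprB addrA subrK addrAC subrr add0r.
    apply: le_lt_trans (ler_normB _ _) _.
    by apply: lt_le_trans (ltrD yx' zx') _; lra.
  by move=> /zvec_small k0; rewrite yk k0 zvec0 addr0.
Qed.

Lemma lift_open_at x (eps : R) : 0 < eps -> exists2 r : R, 0 < r &
  forall y, `|y - F x| < r -> exists2 z, `|z - x| < eps & F z = y.
Proof.
move=> eps0; have [_ /(_ (tpi x))[U [Uo Ux _ Uopen]]] := f_homeo.
have /tpi_continuous/plane_nbhsP[r1 r10 r1U] : nbhs (tpi x) U by exact: open_nbhs_nbhs.
(* Openness of f yields [F z = y] only up to a lattice vector; it vanishes because both points are
   within 1/2 of [F x]. *)
have /plane_continuousP/(_ x 2^-1)[|r2 r20 r2F] := F_cont; first by rewrite invr_gt0.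
pose s := Num.min eps (Num.min r1 r2).
have s0 : 0 < s by rewrite !lt_min eps0 r10.
pose D := [set y | `|y - x| < s].
have Do : open D by exact: disk_open.
have fDo : open (f @` (@tpi R @` D)).
  apply: Uopen; first exact: tpi_open.
  by move=> _ [y + <-]; rewrite /D /= !lt_min => /and3P[_ yr1 _]; exact: r1U.
have /plane_nbhsP[r r0 rP] : nbhs (F x) (@tpi R @^-1` (f @` (@tpi R @` D))).
  apply: open_nbhs_nbhs; split; first exact: fDo.
  rewrite /= F_lift; exists (tpi x); last by [].
  by exists x; rewrite // /D /= subrr normr0.
exists (Num.min r 2^-1); first by rewrite lt_min r0/= invr_gt0.
move=> y; rewrite lt_min => /andP[yr y2].
have [_ [z zD <-]] := rP y yr.
rewrite -F_lift => /tpi_eqP[k Fzk].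
move: zD; rewrite /D /= !lt_min => /and3P[zeps _ zr2].
exists z => //.
suff k0 : k = 0 by rewrite Fzk k0 zvec0 addr0.
apply: (@zvec_small R).
have -> : zvec R k = (F z - F x) - (y - F x) by rewrite Fzk opprB addrA subrK addrAC subrr add0r.
apply: le_lt_trans (ler_normB _ _) _.
by apply: lt_le_trans (ltrD (r2F _ zr2) y2) _; lra.
Qed.

Lemma lift_uniformly_open (eps : R) : 0 < eps -> exists2 r : R, 0 < r &
  forall x y, `|y - F x| < r -> exists2 z, `|z - x| < eps & F z = y.
Proof.
move=> eps0; apply: uniform_periodic.
- move=> r r' x r'0 rr xP y yx; apply: xP; exact: lt_le_trans rr.
- move=> r x k xP y; rewrite F_equi => yx.
  have [|z zx Fz] := xP (y - zvec R (A *m k)); first by rewrite addrAC -addrA -opprD.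
  exists (z + zvec R k); first by rewrite opprD addrACA subrr addr0.
  by rewrite F_equi Fz subrK.
- move=> x; have [|r r0 rP] := @lift_open_at x (eps / 2); first by rewrite divr_gt0.
  have /plane_continuousP/(_ x (r / 2))[|s s0 sF] := F_cont; first by rewrite divr_gt0.
  pose t := Num.min (r / 2) (Num.min s (eps / 2)).
  exists t; first by rewrite !lt_min !divr_gt0// s0.
  move=> x'; rewrite !lt_min => /and3P[_ x's x'eps] y.
  rewrite !lt_min => /and3P[yr _ _].
  have [|z zx Fz] := rP y.
    apply: le_lt_trans (ler_distD (F x') _ _) _.
    by rewrite [ltRHS]splitr ltrD// sF.
  exists z => //; apply: le_lt_trans (ler_distD x _ _) _.
  by rewrite [ltRHS]splitr ltrD// distrC.
Qed.

(* A continuous section of [F] through [p] is also a left inverse, by local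
   injectivity. *)
Lemma lift_bijective : injective F /\ forall y, exists x, F x = y.
Proof.
have [r r0 rinj] := lift_locally_injective.
have section p : exists s : R * R -> R * R,
    [/\ continuous s, forall y, F (s y) = y & s (F p) = p].
  (* With [r / 4] the separation required of the fibres of [F] is exactly the radius of injectivity
     [r]. *)
  have [| | | |s [sc sP sp]] := @uniform_fiber_lift R (fun y e => F e = y) (r / 4) (F p) p;
    last by exists s.
  - by rewrite divr_gt0.
  - move=> x e e' Fe Fe' ee'; apply: (rinj e'); rewrite ?subrr ?normr0//.
      by rewrite mulrCA mulfV ?mulr1 in ee'.
    by rewrite Fe Fe'.
  - move=> eps eps0; have [s s0 sP] := lift_uniformly_open eps0; exists s => // x x' e ex x'x.
    by have [|z zx Fz] := sP e x'; [rewrite ex|exists z].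
  - by [].
split=> [p q Fpq|y]; last by have [s [_ sP _]] := section 0; exists (s y).
have [s [sc sP sp]] := section p.
suff : [set: R * R] `<=` [set x | s (F x) = x] by move/(_ q I) => /=; rewrite -Fpq sp.
have sFc : continuous (s \o F).
  by move=> x; apply: continuous_comp; [exact: F_cont|exact: sc].
have /plane_continuousP sFc' := sFc.
apply: connected_clopen; first exact: plane_connected.
- by exists p.
- move=> x _ /= sx; have [t t0 tP] := sFc' x r r0.
  apply/plane_nbhsP; exists (Num.min t r); first by rewrite lt_min t0.
  move=> y; rewrite lt_min => /andP[yt yr] /=.
  apply: (rinj x) => //.
  by have := tP _ yt; rewrite /= sx.
- move=> x _ /= sx.
  have d0 : 0 < `|s (F x) - x| / 2 by rewrite divr_gt0// normr_gt0 subr_eq0; apply/eqP.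
  have [t t0 tP] := sFc' x _ d0.
  apply/plane_nbhsP; exists (Num.min t (`|s (F x) - x| / 2)); first by rewrite lt_min t0.
  move=> y; rewrite lt_min => /andP[yt yr] /= sy.
  have := tP _ yt; rewrite /= sy => yx.
  have := ltrD yx yr; rewrite -splitr distrC => h.
  have := ler_distD y (s (F x)) x; rewrite leNgt; apply/negP/negPn; exact: h.
Qed.

End LiftProperties.

(** * Degree and homotopy class *)

Section Degree.
Variables (R : realType) (f : torus R -> torus R) (F : R * R -> R * R) (A : 'M[int]_2).
Hypothesis f_homeo : local_homeo f.
Hypothesis F_cont : continuous F.
Hypothesis F_lift : forall x, tpi (F x) = f (tpi x).
Hypothesis F_equi : forall x k, F (x + zvec R k) = F x + zvec R (A *m k).

(* If w A = 0 then w . F is periodic, so it attains a maximum, which is absurd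
   for an open map. *)
Lemma det_neq0 : \det A != 0.
Proof.
apply/negP => /eqP dA.
have /det0P[w w0 wA] : \det (map_mx intr A : 'M[R]_2) == 0 by rewrite det_map_mx dA.
pose phi (x : R * R) := w 0 0 * x.1 + w 0 1 * x.2.
have phiD x y : phi (x + y) = phi x + phi y by rewrite /phi /=; ring.
have phiA k : phi (zvec R (A *m k)) = 0.
  have e0 := congr1 (fun M : 'rV[R]_2 => M 0 0) wA.
  have e1 := congr1 (fun M : 'rV[R]_2 => M 0 1) wA.
  rewrite /= mulmx_rV2 !mxE in e0; rewrite /= mulmx_rV2 !mxE in e1.
  rewrite /phi /zvec /= !mulmx_cV2 !intrD !intrM.
  rewrite (_ : _ + _ = (w 0 0 * (A 0 0)%:~R + w 0 1 * (A 1 0)%:~R) * (k 0 0)%:~R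
    + (w 0 0 * (A 0 1)%:~R + w 0 1 * (A 1 1)%:~R) * (k 1 0)%:~R); last by ring.
  by rewrite e0 e1 !mul0r addr0.
pose K : set (R * R) := `[0, 1]%classic `*` `[0, 1]%classic.
have Kc : compact K by apply: compact_setX; exact: segment_compact.
have K0 : K !=set0 by exists 0; split; rewrite /= in_itv/= lexx ler01.
have phiFc : continuous (phi \o F).
  move=> x; apply: continuous_comp; first exact: F_cont.
  by apply: cvgD; apply: cvgM; [exact: cvg_cst|exact: cvg_fst|exact: cvg_cst|exact: cvg_snd].
have [c _ cmax] := compact_EVT_max K0 Kc (continuous_subspaceT phiFc).
have {}cmax x : phi (F x) <= phi (F c).
  have [k [k1 k2]] := floor_zvec x.
  have -> : phi (F x) = phi (F (x + zvec R k)) by rewrite F_equi phiD phiA addr0.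
  apply: cmax; rewrite inE; split; rewrite /= in_itv/=;
    by [move: k1 => /andP[-> /ltW]|move: k2 => /andP[-> /ltW]].
have [r r0 rP] := lift_open_at f_homeo F_cont F_lift c ltr01.
pose v : R * R := (w 0 0, w 0 1).
have v0 : v != 0.
  apply: contra w0 => /eqP[w00 w01]; apply/eqP/rowP => j; rewrite [RHS]mxE.
  by case: (ord2P j) => ->.
have nv0 : 0 < `|v| by rewrite normr_gt0.
(* A step of length [r / 2] from the maximum in the direction of [w] stays in the image of [F] and
   increases [phi]. *)
pose t := r / 2 / `|v|; have t0 : 0 < t by rewrite !divr_gt0.
have [|z _ Fz] := rP (F c + t *: v).
  rewrite addrAC subrr add0r normrZ gtr0_norm// /t divfK ?gt_eqF//.
  by rewrite ltr_pdivrMr// ltr_pMr// ltr1n.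
have := cmax z; rewrite Fz phiD gerDl leNgt => /negP; apply.
have -> : phi (t *: v) = t * (w 0 0 ^+ 2 + w 0 1 ^+ 2).
  by rewrite /phi /= /GRing.scale /=; ring.
rewrite mulr_gt0// lt_def addr_ge0 ?sqr_ge0// andbT.
rewrite paddr_eq0 ?sqr_ge0// !sqrf_eq0.
by apply: contra v0 => /andP[/eqP w00 /eqP w01]; rewrite /v w00 w01.
Qed.

(** Otherwise [\det A *: \adj A] is an integer inverse of [A]. Lifts of the two points have
    [F]-images that differ by some lattice vector [j]; moving one lift by the inverse image of [j]
    makes the [F]-images equal, so [F] injective identifies the two points. *)
Lemma det_gt1 :
  (exists y1 y2 : torus R, y1 <> y2 /\ f y1 = f y2) -> 1 < `|\det A|.
Proof.
move=> [y1 [y2 [y12 fy]]].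
rewrite ltNge; apply/negP => d1.
have dd : \det A * \det A = 1.
  have : `|\det A| = 1.
    by apply/eqP; rewrite eq_le d1 -[1]add0r lezD1 normr_gt0 det_neq0.
  by move=> h; rewrite -expr2 -real_normK ?num_real// h expr1n.
have [Y1 e1] := tpi_surj y1; have [Y2 e2] := tpi_surj y2.
have /tpi_eqP[j Fj] : tpi (F Y1) = tpi (F Y2) by rewrite !F_lift e1 e2.
have [Finj _] := lift_bijective f_homeo F_cont F_lift F_equi.
apply: y12; rewrite -e1 -e2; apply/tpi_eqP.
exists (\det A *: (\adj A *m j)); apply: Finj.
by rewrite F_equi Fj -scalemxAr mulmxA mul_mx_adj mul_scalar_mx scalerA dd scale1r.
Qed.

(** [F] and the linear map have the same equivariance, hence so does every convex combination of
    them, and the straight-line homotopy descends to the torus. *)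
Lemma homotopic_lin : homotopic R f (torus_lin A).
Proof.
pose lin (x : R * R) : R * R := ((A 0 0)%:~R * x.1 + (A 0 1)%:~R * x.2,
       (A 1 0)%:~R * x.1 + (A 1 1)%:~R * x.2).
have linD x k : lin (x + zvec R k) = lin x + zvec R (A *m k).
  by congr pair; rewrite /= mulmx_cV2 intrD !intrM; ring.
have lin_cont : continuous lin.
  pose c0 : R * R := ((A 0 0)%:~R, (A 1 0)%:~R).
  pose c1 : R * R := ((A 0 1)%:~R, (A 1 1)%:~R).
  have -> : lin = fun x => x.1 *: c0 + x.2 *: c1.
    by apply/funext => x; congr pair; rewrite /= /GRing.scale /=; ring.
  move=> x; apply: cvgD; apply: cvgZ;
    by [exact: cvg_fst|exact: cvg_snd|exact: cvg_cst].
pose h (q : (R * R) * R) := (1 - q.2) *: F q.1 + q.2 *: lin q.1.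
have hD x k t : h (x + zvec R k, t) = h (x, t) + zvec R (A *m k).
  rewrite /h /= F_equi linD !scalerDr addrACA -scalerDl subrK scale1r.
  by [].
have h_cont : continuous h.
  move=> q; apply: cvgD; apply: cvgZ.
  - by apply: cvgB; [exact: cvg_cst|exact: cvg_snd].
  - by apply: (@continuous_comp _ _ _ fst F); [exact: cvg_fst|exact: F_cont].
  - exact: cvg_snd.
  - by apply: (@continuous_comp _ _ _ fst lin); [exact: cvg_fst|exact: lin_cont].
have hE (p : torus R) x t : tpi x = p -> tpi (h (trepr p, t)) = tpi (h (x, t)).
  move=> xp; have /tpi_eqP[k ->] : tpi (trepr p) = tpi x by rewrite treprK.
  by rewrite hD tpiD.
exists (fun q => tpi (h (trepr q.1, q.2))); split.
- apply: continuous_subspaceT => -[p t] W /= Wh.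
  have hpc : continuous (@tpi R \o h).
    by move=> q; apply: continuous_comp; [exact: h_cont|exact: tpi_continuous].
  have [[D I] [/= Dn In] DI] := hpc (trepr p, t) W Wh.
  (* [trepr] is not continuous. Since [tpi] is open, nearby points have some representative in [D],
     and by [hE] any representative may be used. *)
  have pn : nbhs p (@tpi R @` D°).
    apply: open_nbhs_nbhs; split; first exact/tpi_open/open_interior.
    by exists (trepr p); [exact: Dn|rewrite treprK].
  exists (@tpi R @` D°, I); first by split.
  move=> [p' t'] [/= [x Dx xp'] It'].
  rewrite /= (hE _ _ _ xp'); apply: (DI (x, t')); split=> //=.
  exact: interior_subset.
- by move=> p; rewrite /h /= subr0 scale1r scale0r addr0 F_lift treprK.
- by move=> p; rewrite /h /= subrr scale1r scale0r add0r.
Qed.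

End Degree.

(** * Area *)

Section Area.
Variable R : realType.
Implicit Types (S : set (R * R)).

Let mu := ((@lebesgue_measure R) \x (@lebesgue_measure R))%E.

(** Same shape as the set inside [torus_lambda], with [(x.1, x.2)] passing from the measurable
    product to the plane, so that [torus_lambda_area] needs only [areaE]. *)
Definition cell S : set (measurableTypeR R * measurableTypeR R) :=
  [set x | (0 <= x.1 < 1) /\ (0 <= x.2 < 1) /\ S (x.1, x.2)].

Definition area S : R := fine (mu (cell S)).

Lemma unit_cell_measurable : measurable (cell setT).
Proof.
rewrite (_ : cell setT = `[0%R, 1%R[%classic `*` `[0%R, 1%R[%classic).
  by apply: measurableX; exact: measurable_itv.
by apply/seteqP; split=> -[a b]; rewrite /cell /= !in_itv/=; case=> // ? [].
Qed.

Lemma cell_sub S S' : S `<=` S' -> cell S `<=` cell S'.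
Proof. by move=> SS' x [? [? /SS']]. Qed.

(** Measurability is meant in the product sigma-algebra, so [S] is written as a countable union of
    rational squares, each a product of intervals. *)
Lemma open_cell_measurable S : open S -> measurable (cell S).
Proof.
move=> /plane_openP So.
pose box (q : rat * rat * nat) : set (measurableTypeR R * measurableTypeR R) :=
  ball (ratr q.1.1 : R) (q.2.+1%:R^-1 : R) `*` ball (ratr q.1.2 : R) (q.2.+1%:R^-1 : R).
pose B q := if `[< box q `<=` S >] then box q else set0.
have -> : cell S = cell setT `&` \bigcup_q B q.
  apply/seteqP; split=> [[a b]|[a b]].
    move=> [a01 [b01 Sab]]; split; first by split.
    have [r r0 rS] := So _ Sab.
    have [p [q [n []]]] := rational_disk (a, b) r0.
    rewrite norm_pair_lt /= => /andP[pa qb] nr.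
    exists (p, q, n) => //; rewrite /B.
    have -> : `[< box (p, q, n) `<=` S >].
      apply/asboolP => -[c d] [/= pc qd]; apply: rS; rewrite norm_pair_lt /=.
      apply/andP; split; apply: lt_trans nr.
        apply: le_lt_trans (ler_distD (ratr p) _ _) _.
        by rewrite ltrD// distrC.
      apply: le_lt_trans (ler_distD (ratr q) _ _) _.
      by rewrite ltrD// distrC.
    by split.
  move=> [[a01 [b01 _]] [q _]]; rewrite /B; case: asboolP => // qS /qS Sab.
  by split.
apply: measurableI; first exact: unit_cell_measurable.
apply: countable_bigcupT_measurable; first exact: countableP.
move=> q; rewrite /B; case: asboolP => // _.
by apply: measurableX; rewrite ball_itv; exact: measurable_itv.
Qed.

Lemma mu_unit_cell : mu (cell setT) = 1%E.
Proof.
rewrite (_ : cell setT = `[0%R, 1%R[%classic `*` `[0%R, 1%R[%classic); last first.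
  by apply/seteqP; split=> -[a b]; rewrite /cell /= !in_itv/=; case=> // ? [].
rewrite /mu product_measure1E; try exact: measurable_itv.
by rewrite /= lebesgue_measure_itv/= lte_fin ltr01 oppr0 adde0 mule1.
Qed.

Lemma mu_cell_le1 S : open S -> (mu (cell S) <= 1)%E.
Proof.
move=> So; rewrite -mu_unit_cell; apply: le_measure; rewrite ?inE.
- exact: open_cell_measurable.
- exact: unit_cell_measurable.
- exact: cell_sub.
Qed.

Lemma areaE S : open S -> mu (cell S) = (area S)%:E.
Proof.
move=> So; rewrite fineK// ge0_fin_numE ?measure_ge0//.
by apply: le_lt_trans (mu_cell_le1 So) _; rewrite ltry.
Qed.

Lemma area_ge0 S : 0 <= area S.
Proof. by apply: fine_ge0; exact: measure_ge0. Qed.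

Lemma area_le1 S : open S -> area S <= 1.
Proof. by move=> So; rewrite -lee_fin -areaE// mu_cell_le1. Qed.

Lemma area_le S S' : open S -> open S' -> S `<=` S' -> area S <= area S'.
Proof.
move=> So So' SS'; rewrite -lee_fin -!areaE//; apply: le_measure; rewrite ?inE;
  by [exact: open_cell_measurable|exact: cell_sub].
Qed.

Lemma areaU S S' : open S -> open S' -> S `&` S' = set0 ->
  area (S `|` S') = area S + area S'.
Proof.
move=> So So' SS'; apply: EFin_inj; rewrite EFinD -!areaE//; last exact: openU.
rewrite -measureU; first congr (mu _).
- by apply/seteqP; split=> [x [? [? []]]|x [] [? []]]; rewrite /cell /=; tauto.
- exact: open_cell_measurable.
- exact: open_cell_measurable.
- rewrite -subset0 => x [[_ [_ Sx]] [_ [_ S'x]]].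
  by have : (S `&` S') (x.1, x.2) by []; rewrite SS'.
Qed.

Lemma area_gt0 S : open S -> periodic S -> S !=set0 -> 0 < area S.
Proof.
move=> So Sper [x Sx]; have [k [k1 k2]] := floor_zvec x.
have := Sper _ k Sx; move: (x + zvec R k) k1 k2 => y /andP[y10 y11] /andP[y20 y21] Sy.
have /plane_openP/(_ y Sy)[r r0 rS] := So.
(* The square extends only upwards and to the right, as [y] may lie on the lower or left edge of the
   cell; the last two bounds keep it inside. *)
pose s := Num.min r (Num.min (1 - y.1) (1 - y.2)).
have s0 : 0 < s by rewrite !lt_min r0 !subr_gt0 y11.
pose box : set (measurableTypeR R * measurableTypeR R) :=
  `[y.1, y.1 + s[%classic `*` `[y.2, y.2 + s[%classic.
have box_sub : box `<=` cell S.
  move=> [a b]; rewrite /box /cell /= !in_itv/= => -[/andP[a1 a2] /andP[b1 b2]].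
  have sr : s <= r by rewrite ge_min lexx.
  have s1 : s <= 1 - y.1 by rewrite !ge_min lexx orbT.
  have s2 : s <= 1 - y.2 by rewrite !ge_min lexx !orbT.
  split; first by apply/andP; split; lra.
  split; first by apply/andP; split; lra.
  apply: rS; rewrite norm_pair_lt /= !ltr_norml.
  by apply/andP; split; apply/andP; split; lra.
have : (mu box <= (area S)%:E)%E.
  rewrite -areaE//.
  apply: le_measure; rewrite ?inE//; last exact: open_cell_measurable.
  by apply: measurableX; exact: measurable_itv.
rewrite /mu /box product_measure1E; try exact: measurable_itv.
rewrite /= !lebesgue_measure_itv/= !lte_fin !ltrDl s0 -!EFinD -EFinM lee_fin.
apply: lt_le_trans; rewrite !(addrAC _ s) !subrr !add0r.
by rewrite mulr_gt0.
Qed.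

Lemma torus_lambda_area (B : set (torus R)) :
  open B -> torus_lambda B = (area (@tpi R @^-1` B))%:E.
Proof. by move=> Bo; rewrite -areaE. Qed.

End Area.

(** * Invariant open sets and their components *)

Section Saturation.
Variable R : realType.
Implicit Types (S U : set (R * R)) (x y z : R * R) (k : 'cV[int]_2).

Definition saturation S : set (R * R) := [set y | exists k, S (y + zvec R k)].

Lemma saturation_periodic S : periodic (saturation S).
Proof. by move=> y m [k Sy]; exists (k - m); rewrite zvecB [zvec R k - _]addrC addrA addrK. Qed.

Lemma sub_saturation S : S `<=` saturation S.
Proof. by move=> y Sy; exists 0; rewrite zvec0 addr0. Qed.

Lemma saturation_open S : open S -> open (saturation S).
Proof. by move=> /tpi_open; rewrite torus_openE preimage_tpi_image. Qed.

Lemma periodic_saturation S U : periodic U -> S `<=` U -> saturation S `<=` U.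
Proof. by move=> Up SU y [k /SU]; rewrite (periodicP y k Up). Qed.

Lemma component_shift U x y k : periodic U ->
  connected_component U x y -> connected_component U (x + zvec R k) (y + zvec R k).
Proof.
move=> Up xy.
apply: (@connected_component_max _ _ ((fun z => z + zvec R k) @` connected_component U x)).
- exists x => //; apply: connected_component_refl.
  exact: connected_component_sub (connected_component_sym xy).
- by move=> _ [z /connected_component_sub Uz <-]; exact: Up.
- apply: connected_continuous_connected; first exact: component_connected.
  apply: continuous_subspaceT => z.
  by apply: cvgD; [exact: cvg_id|exact: cvg_cst].
- by exists y.
Qed.

Lemma component_image U (G : R * R -> R * R) x y : continuous G ->
  (forall z, U z -> U (G z)) ->
  connected_component U x y -> connected_component U (G x) (G y).
Proof.
move=> Gc GU xy.
apply: (@connected_component_max _ _ (G @` connected_component U x)).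
- exists x => //; apply: connected_component_refl.
  exact: connected_component_sub (connected_component_sym xy).
- by move=> _ [z /connected_component_sub Uz <-]; exact: GU.
- apply: connected_continuous_connected; first exact: component_connected.
  exact: continuous_subspaceT.
- by exists y.
Qed.

End Saturation.

(** * Periodic components of fully invariant open sets *)

Section Dynamics.
Variables (R : realType) (F : R * R -> R * R) (A : 'M[int]_2).
Hypothesis F_cont : continuous F.
Hypothesis F_equi : forall (x : R * R) (k : 'cV[int]_2), F (x + zvec R k) = F x + zvec R (A *m k).
Hypothesis F_surj : forall y, exists x, F x = y.
Hypothesis F_area : forall S : set (R * R), open S -> periodic S -> area (F @^-1` S) = area S.
Hypothesis detA : 1 < `|\det A|.
Implicit Types (S : set (R * R)) (x y z : R * R) (k : 'cV[int]_2) (n : nat).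

Lemma iter_cont n : continuous (iter n F).
Proof.
elim: n => [|n IH] x; first exact: cvg_id.
by apply: (@continuous_comp _ _ _ (iter n F) F); [exact: IH|exact: F_cont].
Qed.

Lemma iter_equi n x k : iter n F (x + zvec R k) = iter n F x + zvec R (A ^+ n *m k).
Proof.
elim: n => [|n IH] /=; first by rewrite expr0 mul1mx.
by rewrite IH F_equi exprS mulmxA.
Qed.

Lemma iter_surj n y : exists x, iter n F x = y.
Proof.
elim: n y => [|n IH] y; first by exists y.
by have [x <-] := F_surj y; have [z <-] := IH x; exists z.
Qed.

Lemma preimage_periodic n S : periodic S -> periodic (iter n F @^-1` S).
Proof. by move=> Sp x k /= Sx; rewrite iter_equi; exact: Sp. Qed.

Lemma preimage_open n S : open S -> open (iter n F @^-1` S).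
Proof. by move=> So; apply: open_comp => // x _; exact: iter_cont. Qed.

Lemma iter_area n S : open S -> periodic S -> area (iter n F @^-1` S) = area S.
Proof.
elim: n S => [//|n IH] S So Sp.
rewrite -[RHS](F_area So Sp) -(IH (F @^-1` S)) //.
- exact: (@preimage_open 1).
- exact: (@preimage_periodic 1).
Qed.

Section InvariantSet.
Variable U : set (R * R).
Hypothesis U_open : open U.
Hypothesis U_per : periodic U.
Hypothesis U_inv : forall x, U (F x) <-> U x.

Let comp := connected_component U.
Let sat x := saturation (comp x).

Let U_iter n x : U (iter n F x) <-> U x.
Proof. by elim: n => [//|n IH] /=; rewrite U_inv. Qed.

Let sat_open x : open (sat x).
Proof. by apply: saturation_open; apply: component_open. Qed.

Let sat_sub x : sat x `<=` U.
Proof. by apply: periodic_saturation => //; exact: connected_component_sub. Qed.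

Let sat_area_gt0 x : U x -> 0 < area (sat x).
Proof.
move=> Ux; apply: area_gt0 => //; first exact: saturation_periodic.
by exists x; apply: sub_saturation; exact: connected_component_refl.
Qed.

Let sat_comp x y z : sat x y -> comp y z -> sat x z.
Proof.
move=> [k xy] yz; exists k; apply: connected_component_trans xy _.
exact: component_shift.
Qed.

Let sat_iter n x : sat x `<=` iter n F @^-1` sat (iter n F x).
Proof.
move=> y [k xy]; exists (A ^+ n *m k); rewrite -iter_equi.
by apply: component_image => //; [exact: iter_cont|move=> z Uz; exact/U_iter].
Qed.

(* The saturated components along an orbit have nondecreasing positive area,
   so they cannot be pairwise disjoint. *)
Lemma recurrent_component x : U x ->
  exists i j : nat, (i < j)%N /\ sat (iter i F x) `&` sat (iter j F x) !=set0.
Proof.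
move=> Ux; apply: contrapT => disj.
pose S i := sat (iter i F x).
have Sarea i : area (S 0%N) <= area (S i).
  elim: i => [//|i IH]; apply: le_trans IH _.
  rewrite -(iter_area 1 (@sat_open (iter i.+1 F x)) (@saturation_periodic _ _)).
  apply: area_le; [exact: sat_open| |exact: (@sat_iter 1)].
  exact/preimage_open/sat_open.
pose T n := \bigcup_(i in [set i | (i < n)%N]) S i.
have To n : open (T n) by apply: bigcup_open => i _; exact: sat_open.
have TS n : T n.+1 = T n `|` S n.
  apply/seteqP; split=> [y [i /= + Sy]|y [[i /= iN Sy]|Sy]].
  - by rewrite ltnS leq_eqVlt => /orP[/eqP <-|iN]; [right|left; exists i].
  - by exists i => //=; exact: ltnW.
  - by exists n => /=.
have Tarea n : n%:R * area (S 0%N) <= area (T n).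
  elim: n => [|n IH]; first by rewrite mul0r area_ge0.
  rewrite TS areaU//; last first.
    rewrite -subset0 => y [[i /= iN Siy] Sny]; apply: disj.
    by exists i, n; split=> //; exists y.
    exact: sat_open.
  by rewrite -natr1 mulrDl mul1r lerD.
have a0 : 0 < area (S 0%N) by exact: sat_area_gt0.
(* So many disjoint sets of at least this area would exceed the total area 1. *)
pose n := (Num.truncn (area (S 0%N))^-1).+1.
have : 1 < n%:R * area (S 0%N) by rewrite -ltr_pdivrMr// div1r truncnS_gt.
by rewrite ltNge (le_trans (Tarea n))// area_le1.
Qed.

Lemma invariant_component (x : R * R) : U x ->
  (exists mu : R, `|mu| = 1 /\ eigenvalue (map_mx intr A) mu) \/
  exists O : set (R * R), [/\ open O, connected O, O !=set0, O `<=` U &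
    exists2 N : R, 0 < N & forall y, O y ->
      [/\ O (y + (N, 0)), O (y - (N, 0)), O (y + (0, N)) & O (y - (0, N))]].
Proof.
move=> Ux; have [i [j [ij [y [[k ki] [k' kj]]]]]] := recurrent_component Ux.
pose p := iter i F x; pose n := (j - i)%N; pose G := iter n F.
have Gp : G p = iter j F x by rewrite /G /p -iterD subnK// ltnW.
have Up : U p by apply/U_iter.
(* Translates of [O] are components too, so a translate that meets [O] equals it, and the single
   point [p] decides which vectors stabilize [O]. *)
pose O := comp p.
have Op : O p by exact: connected_component_refl.
have O_same z : O z -> O = comp z by exact: same_connected_component.
have O_shift z w m : O z -> O (z + zvec R m) -> O w -> O (w + zvec R m).
  move=> Oz Ozm Ow; rewrite (O_same _ Ozm); apply: component_shift => //.
  by rewrite -/comp -(O_same _ Oz).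
have O_unshift z w m : O z -> O (z + zvec R m) -> O w -> O (w - zvec R m).
  move=> Oz Ozm; rewrite {1}(O_same _ Ozm) => /(component_shift (- m) U_per).
  by rewrite zvecN addrK -/comp -(O_same _ Oz).
(* [y + k] lies in [O] and [y + k'] in the component of [G p]; translation by the difference
   therefore carries the latter onto [O]. *)
pose c := k - k'.
have GO z : O z -> O (G z + zvec R c).
  move=> Oz; have Gz : comp (G p) (G z).
    by apply: component_image => //; [exact: iter_cont|move=> w Uw; exact/U_iter].
  have Gy : comp (y + zvec R k') (G z).
    by apply: connected_component_trans Gz; apply: connected_component_sym; rewrite Gp.
  have := component_shift c U_per Gy.
  rewrite {2}/c zvecB [zvec R k - _]addrC addrA addrK => h.
  exact: connected_component_trans ki h.
have GB z m : G (z + zvec R m) = G z + zvec R (A ^+ n *m m) by exact: iter_equi.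
(* The preimage of [sat p] contains [sat p] and has the same area; a disjoint [sat z] inside it
   would add positive area. *)
have pre_sat z : sat p (G z) -> sat p z.
  move=> pGz; apply: contrapT => npz.
  have Uz : U z by apply/(U_iter n); exact: sat_sub pGz.
  have disj : sat p `&` sat z = set0.
    rewrite -subset0 => w [[m pw] [m' zw]]; apply: npz; exists (m - m').
    have := component_shift (m - m') U_per zw.
    rewrite {2}zvecB [zvec R m - _]addrC addrA addrK => h.
    by apply: connected_component_trans pw _; exact: connected_component_sym.
  have sub : sat p `|` sat z `<=` G @^-1` sat p.
    move=> w [[m Ow]|[m zw]].
      exists (A ^+ n *m m + c); rewrite zvecD addrA -GB; exact: GO.
    have : comp (G z) (G (w + zvec R m)).
      by apply: component_image => //; [exact: iter_cont|move=> v Uv; exact/U_iter].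
    rewrite GB => /(sat_comp pGz) pw.
    exact/(periodicP (G w) (A ^+ n *m m) (@saturation_periodic R (comp p))).
  have := area_le (openU (@sat_open p) (@sat_open z)) (preimage_open (n := n) (@sat_open p)) sub.
  rewrite (iter_area _ (@sat_open p) (@saturation_periodic _ _)) areaU//.
  by rewrite gerDl leNgt sat_area_gt0.
have [|||||e|[N N0 [HN1 HN2]]] := @stabilizer_dichotomy A n
    (fun m => O (p + zvec R m)) detA _ _ _ _ _ R; last 2 first.
- by left.
- right; exists O; split.
  + exact: component_open.
  + exact: component_connected.
  + by exists p.
  + exact: connected_component_sub.
  + exists (N%:~R); first by rewrite ltr0z.
    have e1 : zvec R (cV2 N 0) = (N%:~R, 0) by rewrite /zvec cV2_0 cV2_1.
    have e2 : zvec R (cV2 0 N) = (0, N%:~R) by rewrite /zvec cV2_0 cV2_1.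
    move=> w Ow; rewrite -e1 -e2; split.
    * exact: O_shift Op HN1 Ow.
    * exact: O_unshift Op HN1 Ow.
    * exact: O_shift Op HN2 Ow.
    * exact: O_unshift Op HN2 Ow.
- by rewrite subn_gt0.
- by rewrite zvec0 addr0.
- by move=> v w Hv Hw; rewrite zvecB addrA; exact: O_unshift Op Hw Hv.
(* The points [G p + c] and [G p + c + A ^+ n v] both lie in [O], so their difference stabilizes
   [O]. *)
- move=> v Hv; have := GO _ Hv; rewrite GB addrAC => h.
  exact: O_shift (GO _ Op) h Op.
(* This [z] lies in a translate of [O], say [z + m] in [O]; then [G (z + m) + c], which is
   [p + w + A ^+ n m], lies in [O], whence the witness [- m]. *)
- move=> w; have [z Gz] := iter_surj n (p + zvec R (w - c)).
  have [m Om] : sat p z.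
    by apply: pre_sat; rewrite /G Gz; apply: saturation_periodic; apply: sub_saturation.
  exists (- m); have := GO _ Om; rewrite GB /G Gz.
  rewrite mulmxN opprK -!addrA -!zvecD; congr (O (p + zvec R _)).
  by rewrite -addrA; congr (w + _); rewrite addrC addrK.
Qed.

End InvariantSet.
End Dynamics.

(** * Transitivity *)

(* Lets products of complete normed modules inherit pointed uniform structures,
   which Baire's theorem requires of [R * R]. *)
HB.saturate prod.

(** Both projections of a Cauchy filter are Cauchy, and the pair of their limits is a limit. This
    makes the plane complete, for the category argument below. *)
Lemma prod_cauchy_cvg (K : numFieldType) (T U : completeNormedModType K) (F : set_system (T * U)) :
  ProperFilter F -> cauchy F -> cvg F.
Proof.
move=> FF Fc.
have c1 : cauchy (fst @ F).
  move=> E entE.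
  have [] := Fc [set p | E (p.1.1, p.2.1)].
    exists (E, setT) => //=; first by split=> //; exact: entourageT.
    by move=> [[a b] [c d]] [/= ? ?]; exists ((a, c), (b, d)).
  move=> [P Q] [/= FP FQ] PQ; exists (fst @` P, fst @` Q).
    by split; [apply: filterS FP|apply: filterS FQ] => x ?; exists x.
  move=> [a b] [/= [x Px <-] [y Qy <-]].
  exact: (PQ (x, y)).
have c2 : cauchy (snd @ F).
  move=> E entE.
  have [] := Fc [set p | E (p.1.2, p.2.2)].
    exists (setT, E) => //=; first by split=> //; exact: entourageT.
    by move=> [[a b] [c d]] [/= ? ?]; exists ((a, c), (b, d)).
  move=> [P Q] [/= FP FQ] PQ; exists (snd @` P, snd @` Q).
    by split; [apply: filterS FP|apply: filterS FQ] => x ?; exists x.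
  move=> [a b] [/= [x Px <-] [y Qy <-]].
  exact: (PQ (x, y)).
have /cvg_ex[a Fa] : cvg (fst @ F) by apply: cauchy_cvg.
have /cvg_ex[b Fb] : cvg (snd @ F) by apply: cauchy_cvg.
apply/cvg_ex; exists (a, b).
move=> W [[P Q] [/= aP bQ] PQ].
have h1 : F (fst @^-1` P) := Fa _ aP; have h2 : F (snd @^-1` Q) := Fb _ bQ.
by apply: filterS (filterI h1 h2) => x [? ?]; exact: (PQ x).
Qed.

HB.instance Definition _ (K : numFieldType) (U V : completeNormedModType K) :=
  Uniform_isComplete.Build (U * V)%type (@prod_cauchy_cvg K U V).
Section Transitivity.
Variables (R : realType) (f : torus R -> torus R) (F : R * R -> R * R) (A : 'M[int]_2).
Hypothesis F_cont : continuous F.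
Hypothesis F_lift : forall x : R * R, tpi (F x) = f (tpi x).
Hypothesis F_equi : forall (x : R * R) (k : 'cV[int]_2),
  F (x + zvec R k) = F x + zvec R (A *m k).
Implicit Types (U V S : set (R * R)) (x y z : R * R) (n : nat).

Lemma tpi_iter n x : tpi (iter n F x) = iter n f (tpi x).
Proof. by elim: n => [//|n IH] /=; rewrite F_lift IH. Qed.

(** Birkhoff's criterion: for each rational disk, the points whose orbit meets its saturation form a
    dense open set, and a point in all of these projects to one with dense orbit. *)
Lemma transitive_of_open_hitting :
  (forall U V, open U -> periodic U -> U !=set0 -> open V -> periodic V -> V !=set0 ->
    exists n x, U x /\ V (iter n F x)) ->
  transitive_map f.
Proof.
move=> hit.
pose center (q : rat * rat * nat) : R * R := (ratr q.1.1, ratr q.1.2).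
pose disk q := saturation [set y | `|y - center q| < q.2.+1%:R^-1].
have disk_ne q : disk q !=set0.
  exists (center q); apply: sub_saturation.
  by rewrite /= subrr normr0 invr_gt0 ltr0n.
have disk_o q : open (disk q) by apply: saturation_open; exact: disk_open.
(* Codes that name no disk contribute the whole plane, so the intersection is unaffected. *)
pose C (i : nat) : set (R * R) :=
  if unpickle i is Some q then \bigcup_n (iter n F @^-1` disk q) else setT.
have Cod i : open (C i) /\ dense (C i).
  rewrite /C; case: unpickle => [q|]; last first.
    by split; [exact: openT|move=> D [x Dx] _; exists x].
  split; first by apply: bigcup_open => n _; exact: preimage_open.
  move=> D D0 Do.
  have [||||||n [x [[k Dx] qx]]] := hit (saturation D) (disk q) => //.
  - exact: saturation_open.
  - exact: saturation_periodic.
  - by have [x Dx] := D0; exists x; exact: sub_saturation.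
  - exact: saturation_periodic.
  - exists (x + zvec R k); split=> //; exists n => //=.
    by rewrite (iter_equi F_equi); exact: saturation_periodic.
have [x [_ xC]] : setT `&` \bigcap_i C i !=set0.
  by apply: (Baire Cod); [exists 0|exact: openT].
exists (tpi x) => B [b Bb] Bo.
have [y yb] := tpi_surj b.
have /plane_openP/(_ y)[|r r0 rB] : open (@tpi R @^-1` B) by rewrite -torus_openE.
  by rewrite /= yb.
have [p1 [p2 [n [p12 nr]]]] := rational_disk y r0.
have := xC (pickle (p1, p2, n)) I; rewrite /C pickleK => -[m _ [k /= xk]].
exists (iter m f (tpi x)); split; last by exists m.
rewrite -tpi_iter -(tpiD _ k); apply: rB.
apply: le_lt_trans (ler_distD (center (p1, p2, n)) _ _) _.
by apply: lt_trans nr; rewrite ltrD.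
Qed.

End Transitivity.

(** * From backward invariance to full invariance *)

Section InvariantClosure.
Variables (R : realType) (F : R * R -> R * R) (A : 'M[int]_2).
Hypothesis F_cont : continuous F.
Hypothesis F_equi : forall (x : R * R) (k : 'cV[int]_2),
  F (x + zvec R k) = F x + zvec R (A *m k).
Hypothesis F_open_at : forall (x : R * R) (eps : R), 0 < eps -> exists2 r : R, 0 < r &
  forall y : R * R, `|y - F x| < r -> exists2 z : R * R, `|z - x| < eps & F z = y.
Hypothesis F_area : forall S : set (R * R), open S -> periodic S -> area (F @^-1` S) = area S.
Implicit Types (U V W S K : set (R * R)) (x y z : R * R) (n : nat).

Lemma plane_closureP W x : closure W x <->
  forall r : R, 0 < r -> exists2 y, W y & `|y - x| < r.
Proof.
split=> [Wx r r0|Wx D /plane_nbhsP[r r0 rD]].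
  have [|y [Wy yx]] := Wx [set y | `|y - x| < r]; last by exists y.
  by apply/plane_nbhsP; exists r.
by have [y Wy yx] := Wx r r0; exists y; split=> //; exact: rD.
Qed.

Lemma closure_periodic W : periodic W -> periodic (closure W).
Proof.
move=> Wp x k /plane_closureP Wx; apply/plane_closureP => r /Wx[y Wy yx].
by exists (y + zvec R k); [exact: Wp|rewrite opprD addrACA subrr addr0].
Qed.

Lemma interior_periodic K : periodic K -> periodic K°.
Proof.
move=> Kp x k /plane_nbhsP[r r0 rK]; apply/plane_nbhsP; exists r => // y yx.
rewrite -[y](subrK (zvec R k)); apply: Kp; apply: rK.
by rewrite addrAC -addrA -opprD.
Qed.

(* [F^-1 W] has full area in [W], hence is dense in it. *)
Lemma closure_invariant W : open W -> periodic W -> (forall x, W (F x) -> W x) ->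
  forall x, closure W (F x) <-> closure W x.
Proof.
move=> Wo Wp WF x.
have preo : open (F @^-1` W) := preimage_open F_cont (n := 1) Wo.
have prep : periodic (F @^-1` W) := preimage_periodic F_equi (n := 1) Wp.
have pre_dense y : W y -> closure (F @^-1` W) y.
  move=> Wy; apply: contrapT => nWy.
  pose E := W `\` closure (F @^-1` W).
  have Eo : open E.
    by apply: openI => //; rewrite openC; exact: closed_closure.
  have Ep : periodic E.
    move=> z k [Wz nz]; split; first exact: Wp.
    by move=> h; apply: nz; apply/(periodicP z k (closure_periodic prep)).
  have := area_gt0 Eo Ep (ex_intro _ y (conj Wy nWy)).
  have : area (F @^-1` W) + area E <= area W.
    rewrite -areaU//; first by apply: area_le => //; [exact: openU|move=> z [/WF|[]]].
    by rewrite -subset0 => z [Fz [_ nz]]; apply: nz; exact: subset_closure.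
  by rewrite F_area// gerDl leNgt => /negP.
split=> /plane_closureP Wx; apply/plane_closureP => r r0.
  have [s s0 sP] := F_open_at x r0.
  have [w Ww /sP[z zx Fz]] := Wx s s0.
  by exists z => //; apply: WF; rewrite Fz.
have /plane_continuousP/(_ x r r0)[s s0 sF] := F_cont.
have s20 : 0 < s / 2 by rewrite divr_gt0.
have [y Wy yx] := Wx _ s20.
have /plane_closureP/(_ _ s20)[z Fz zy] := pre_dense _ Wy.
exists (F z) => //; apply: sF; apply: le_lt_trans (ler_distD y _ _) _.
by rewrite [ltRHS]splitr ltrD.
Qed.

Lemma interior_invariant K : (forall x, K (F x) <-> K x) ->
  forall x, K° (F x) <-> K° x.
Proof.
move=> KF x; split=> /plane_nbhsP[r r0 rK]; apply/plane_nbhsP.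
  have /plane_continuousP/(_ x r r0)[s s0 sF] := F_cont.
  by exists s => // y /sF /rK /KF.
have [s s0 sP] := F_open_at x r0; exists s => // y /sP[z zx <-].
by apply/KF; exact: rK.
Qed.

(** The points whose orbit meets [V] form an open set [W] that misses [U] but is only backward
    invariant. Its closure is fully invariant; the complement of the closure still contains [U], and
    the interior of the closure contains [V]. *)
Lemma invariant_open_sets U V :
  open U -> U !=set0 -> open V -> periodic V -> V !=set0 ->
  (forall n x, U x -> ~ V (iter n F x)) ->
  exists U' V', [/\ open U', periodic U', U' !=set0 & forall x, U' (F x) <-> U' x] /\
    [/\ open V', periodic V', V' !=set0, forall x, V' (F x) <-> V' x &
        U' `&` V' = set0].
Proof.
move=> Uo [u Uu] Vo Vp [v Vv] UV.
pose W := \bigcup_n (iter n F @^-1` V).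
have Wo : open W by apply: bigcup_open => n _; exact: preimage_open.
have Wp : periodic W.
  by move=> x k [n _ Vx]; exists n => //; exact: preimage_periodic Vx.
have WF x : W (F x) -> W x by move=> [n _ Vx]; exists n.+1 => //; rewrite /preimage /mkset iterSr.
have Kinv := closure_invariant Wo Wp WF.
exists (~` closure W), (closure W)°; split; split.
- by rewrite openC; exact: closed_closure.
- move=> x k nx h; apply: nx; exact/(periodicP x k (closure_periodic Wp)).
- exists u => /(_ U)[|x [[n _ Vx] Ux]]; last exact: UV Vx.
  exact: open_nbhs_nbhs.
- by move=> x; split=> h /Kinv.
- exact: open_interior.
- exact/interior_periodic/closure_periodic.
- exists v; apply: (interiorS (@subset_closure _ W)).
  by rewrite (interior_id _).1//; exists 0%N.
- exact: interior_invariant.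
- by rewrite -subset0 => x [nx /interior_subset].
Qed.

End InvariantClosure.

Theorem theorem1 (R : realType) (f : torus R -> torus R) :
  local_homeo f ->
  (* area preserving *)
  (forall B : set (torus R), torus_borel B ->
     torus_lambda (f @^-1` B) = torus_lambda B) ->
  (* degree at least two: every preimage has at least two points *)
  (forall x : torus R, exists y1 y2 : torus R,
     [/\ y1 <> y2, f y1 = x & f y2 = x]) ->
  ~ transitive_map f ->
  exists A : 'M[int]_2,
    [/\ \det A != 0,
        homotopic R f (torus_lin A) &
        exists mu : R, `|mu| = 1 /\ eigenvalue (map_mx intr A) mu].
Proof.
move=> f_homeo f_area f_deg f_ntrans.
have [f_cont _] := f_homeo.
have [F [F_cont F_lift]] := torus_lift f_cont.
have [A F_equi] := lift_equivariant F_cont F_lift.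
exists A; split.
- exact: (det_neq0 f_homeo F_cont F_lift F_equi).
- exact: homotopic_lin F_cont F_lift F_equi.
have detA : 1 < `|\det A|.
  apply: (det_gt1 f_homeo F_cont F_lift F_equi).
  by have [y1 [y2 [y12 e1 e2]]] := f_deg (tpi 0); exists y1, y2; rewrite e1 e2.
have [_ F_surj] := lift_bijective f_homeo F_cont F_lift F_equi.
have F_open_at := lift_open_at f_homeo F_cont F_lift.
(* A periodic open set is the full preimage of its open, hence Borel, image in the torus, where the
   hypothesis on f applies. *)
have F_area (S : set (R * R)) : open S -> periodic S -> area (F @^-1` S) = area S.
  move=> So Sp; pose B := @tpi R @` S.
  have Bo : open B by exact: tpi_open.
  have preB : @tpi R @^-1` B = S by exact: periodic_image.
  have preFB : @tpi R @^-1` (f @^-1` B) = F @^-1` S.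
    by rewrite -preB; apply/seteqP; split=> x; rewrite /= F_lift.
  have fBo : open (f @^-1` B) by apply: open_comp => // x _; exact: f_cont.
  apply: EFin_inj; rewrite -{1}preFB -preB -!torus_lambda_area//.
  by apply: f_area; exact: sub_sigma_algebra.
have [U [V [Uo [Up [U0 [Vo [Vp [V0 UV]]]]]]]] : exists U V : set (R * R),
    open U /\ periodic U /\ U !=set0 /\ open V /\ periodic V /\ V !=set0 /\
    forall n x, U x -> ~ V (iter n F x).
  apply: contrapT => no; apply: f_ntrans.
  apply: (transitive_of_open_hitting F_cont F_lift F_equi) => U V Uo Up U0 Vo Vp V0.
  apply: contrapT => nh; apply: no; exists U, V; do !split=> //.
  by move=> n x Ux Vx; apply: nh; exists n, x.
have [U' [V' [[Uo' Up' [u Uu] Uinv] [Vo' Vp' [v Vv] Vinv UV']]]] :=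
  invariant_open_sets F_cont F_equi F_open_at F_area Uo U0 Vo Vp V0 UV.
have [e|[D1 [D1o D1c D10 D1U [N N0 D1N]]]] :=
  invariant_component F_cont F_equi F_surj F_area detA Uo' Up' Uinv Uu;
  first exact: e.
have [e|[D2 [D2o D2c D20 D2V [M M0 D2M]]]] :=
  invariant_component F_cont F_equi F_surj F_area detA Vo' Vp' Vinv Vv;
  first exact: e.
(* [D1] enters with its horizontal periods and [D2] with its vertical ones. *)
have [||x [D1x D2x]] := periodic_connected_meet N0 M0 D1o D1c D10 D2o D2c D20.
- by move=> x /D1N[].
- by move=> x /D2M[].
have : (U' `&` V') x by split; [exact: D1U|exact: D2V].
by rewrite UV'.
Qed.
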